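(* Let $\mathcal{A}\subset R_d$ and $\mathcal{B}\subset R_e$ be elements of $\mathcal{M}(Q)$, where $d,e\in\mathbf{N}I$. Then $$\operatorname{codim}(\mathcal{A}*\mathcal{B})=\operatorname{codim}\mathcal{A}+\operatorname{codim}\mathcal{B}-\langle e,d\rangle+r,$$ where $r\in\mathbf{N}$ is such that $0\le r\le \mathrm{hom}(\mathcal{B},\mathcal{A})$.
   Context: $k$ is an algebraically closed field of characteristic $0$, and $Q$ is a finite quiver without oriented cycles with vertex set $I$. $\mathbf{Z}I$ is the free abelian group on symbols $\sigma_i$ ($i\in I$), and $\mathbf{N}I\subset\mathbf{Z}I$ is the set of vectors with nonnegative integer coordinates ($0\in\mathbf{N}$). The Euler form is $\langle d,e\rangle=\sum_{i\in I}d_ie_i-\sum_{i\to j}d_ie_j$ (second sum over all arrows of $Q$). For $d\in\mathbf{N}I$, $R_d=\bigoplus_{\alpha:i\to j}\mathrm{Hom}_k(k^{d_i},k^{d_j})$ is the affine variety of representations of $Q$ of dimension vector $d$ (points are identified with representations), acted on by $G_d=\prod_{i\in I}\mathrm{GL}_{d_i}(k)$ by base change. For $\mathcal{A}\subset R_d$, $\mathcal{B}\subset R_e$, the set $\mathcal{A}*\mathcal{B}\subset R_{d+e}$ consists of all $X\in R_{d+e}$ for which there is an exact sequence of representations $0\to N\to X\to M\to 0$ with $M\in\mathcal{A}$, $N\in\mathcal{B}$. $\mathcal{M}(Q)$ denotes the set of all irreducible, closed, $G_d$-stable subvarieties of the varieties $R_d$, $d\in\mathbf{N}I$; it is a monoid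 under $*$ with unit $R_0$. For $\mathcal{A}\subset R_d$ in $\mathcal{M}(Q)$, $\operatorname{codim}\mathcal{A}:=\dim R_d-\dim\mathcal{A}$. For $\mathcal{A}\subset R_d$, $\mathcal{B}\subset R_e$ in $\mathcal{M}(Q)$, $\mathrm{hom}(\mathcal{B},\mathcal{A}):=\min\{\dim_k\mathrm{Hom}_{kQ}(B,A): A\in\mathcal{A},\,B\in\mathcal{B}\}$. *)

(* Defs.v *)
From Stdlib Require Import ClassicalEpsilon.
From HB Require Import structures.
From mathcomp Require Import all_boot all_order all_algebra.
From mathcomp Require Export mpoly.

Set Implicit Arguments.
Unset Strict Implicit.
Unset Printing Implicit Defensive.

Import GRing.Theory.
Local Open Scope ring_scope.

(* The value is unspecified when P has no least (resp. greatest) element. *)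
Definition minimum (P : nat -> Prop) : nat :=
  epsilon (inhabits 0%N) (fun n => P n /\ forall m, P m -> (n <= m)%N).

Definition maximum (P : nat -> Prop) : nat :=
  epsilon (inhabits 0%N) (fun n => P n /\ forall m, P m -> (m <= n)%N).

Record quiver := Quiver {
  vertex : finType;
  arrow : finType;
  src : arrow -> vertex;
  tgt : arrow -> vertex }.

Definition adjacent (Q : quiver) : rel (vertex Q) :=
  fun i j => [exists a : arrow Q, (src a == i) && (tgt a == j)].

Definition acyclic_quiver (Q : quiver) : Prop :=
  forall p : seq (vertex Q), cycle (@adjacent Q) p -> p = [::].

Definition dimvec (Q : quiver) := vertex Q -> nat.

Definition dimvec_add (Q : quiver) (d e : dimvec Q) : dimvec Q :=
  fun i => (d i + e i)%N.

Definition euler (Q : quiver) (d e : vertex Q -> int) : int :=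
  \sum_(i : vertex Q) d i * e i - \sum_(a : arrow Q) d (src a) * e (tgt a).

(* The space of families (X_t)_(t : T) of matrices of size m t x n t, stored   *)
(* through its coordinates so that it is an affine space in the coordinates    *)
(* [mxcoord m n] and a finite dimensional vector space.  A matrix 'M_(p, q) is *)
(* a linear map k^p -> k^q acting on row vectors.                              *)
Definition mxcoord (T : finType) (m n : T -> nat) : finType :=
  {t : T & ('I_(m t) * 'I_(n t))%type}.

Definition mxfam (k : fieldType) (T : finType) (m n : T -> nat) :=
  {ffun mxcoord m n -> k^o}.

Definition mxof (k : fieldType) (T : finType) (m n : T -> nat)
    (X : mxfam k m n) (t : T) : 'M[k]_(m t, n t) :=
  \matrix_(i, j) X (Tagged (fun t => ('I_(m t) * 'I_(n t))%type) (i, j)).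

Definition mkfam (k : fieldType) (T : finType) (m n : T -> nat)
    (F : forall t, 'M[k]_(m t, n t)) : mxfam k m n :=
  [ffun c => F (tag c) (tagged c).1 (tagged c).2].

Lemma mxof_mkfam (k : fieldType) (T : finType) (m n : T -> nat)
    (F : forall t, 'M[k]_(m t, n t)) t : mxof (mkfam F) t = F t.
Proof. by apply/matrixP => i j; rewrite mxE ffunE. Qed.

Lemma mkfam_mxof (k : fieldType) (T : finType) (m n : T -> nat)
    (X : mxfam k m n) : mkfam (mxof X) = X.
Proof. by apply/ffunP => -[t [i j]]; rewrite ffunE mxE. Qed.

Lemma mxofP (k : fieldType) (T : finType) (m n : T -> nat)
    (a : k) (X Y : mxfam k m n) t :
  mxof (a *: X + Y) t = a *: mxof X t + mxof Y t.
Proof. by apply/matrixP => i j; rewrite !mxE !ffunE. Qed.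

Definition rep (k : fieldType) (Q : quiver) (d : dimvec Q) :=
  mxfam k (fun a : arrow Q => d (src a)) (fun a : arrow Q => d (tgt a)).

Section Hom.
Variables (k : fieldType) (Q : quiver) (e d : dimvec Q).
Variables (N : rep k e) (M : rep k d).

Definition hom_defect (f : mxfam k e d) :
    mxfam k (fun a : arrow Q => e (src a)) (fun a : arrow Q => d (tgt a)) :=
  mkfam (fun a => mxof N a *m mxof f (tgt a) - mxof f (src a) *m mxof M a).

Lemma hom_defect_is_linear : linear hom_defect.
Proof.
move=> c f g; apply/ffunP => -[a [i j]]; rewrite !ffunE /=.
rewrite !mxofP mulmxDl mulmxDr -scalemxAl -scalemxAr.
by rewrite !mxE /GRing.scale /= mulrBr opprD addrACA.
Qed.

HB.instance Definition _ := GRing.isLinear.Build k _ _ _ hom_defect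
  hom_defect_is_linear.

Definition Hom : {vspace mxfam k e d} := lker (linfun hom_defect).

Lemma HomP (f : mxfam k e d) :
  reflect (forall a : arrow Q,
             mxof N a *m mxof f (tgt a) = mxof f (src a) *m mxof M a)
          (f \in Hom).
Proof.
rewrite memv_ker lfunE /=; apply: (iffP eqP) => [h a | h].
  have := congr1 (fun X => mxof X a) h; rewrite mxof_mkfam => /eqP.
  have -> : mxof (0 : mxfam k (fun a => e (src a)) (fun a => d (tgt a))) a = 0.
    by apply/matrixP => i j; rewrite !mxE ffunE.
  by rewrite subr_eq0 => /eqP.
by apply/ffunP => -[a [i j]]; rewrite !ffunE /= h subrr mxE.
Qed.

End Hom.

(* 0 -> N -> X -> M -> 0 is exact iff it is exact at every vertex. *)
Definition short_exact (k : fieldType) (Q : quiver) (e c d : dimvec Q)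
    (f : mxfam k e c) (g : mxfam k c d) : Prop :=
  forall i : vertex Q,
    [/\ row_free (mxof f i), (mxof f i == kermx (mxof g i))%MS
      & row_full (mxof g i)].

Definition extension_set (k : fieldType) (Q : quiver) (d e : dimvec Q)
    (A : rep k d -> Prop) (B : rep k e -> Prop) :
    rep k (dimvec_add d e) -> Prop :=
  fun X => exists (M : rep k d) (N : rep k e)
                  (f : mxfam k e (dimvec_add d e))
                  (g : mxfam k (dimvec_add d e) d),
    [/\ A M, B N, f \in Hom N X, g \in Hom X M & short_exact f g].

Definition rep_act (k : fieldType) (Q : quiver) (d : dimvec Q)
    (g : forall i : vertex Q, 'M[k]_(d i)) (X : rep k d) : rep k d :=
  mkfam (fun a => g (src a) *m mxof X a *m invmx (g (tgt a))).

Definition stable (k : fieldType) (Q : quiver) (d : dimvec Q)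
    (A : rep k d -> Prop) : Prop :=
  forall g : forall i : vertex Q, 'M[k]_(d i),
    (forall i, g i \in unitmx) -> forall X, A X -> A (rep_act g X).

(* Polynomial functions on R_d: one variable for each matrix entry. *)
Definition rep_mpoly (k : fieldType) (Q : quiver) (d : dimvec Q) :=
  {mpoly k[#|mxcoord (fun a : arrow Q => d (src a)) (fun a => d (tgt a))|]}.

Definition rep_eval (k : fieldType) (Q : quiver) (d : dimvec Q)
    (p : rep_mpoly k d) (X : rep k d) : k :=
  p.@[fun i => X (enum_val i)].

Definition zariski_closed (k : fieldType) (Q : quiver) (d : dimvec Q)
    (A : rep k d -> Prop) : Prop :=
  exists S : rep_mpoly k d -> Prop,
    forall X, A X <-> forall p, S p -> rep_eval p X = 0.

Definition irreducible_set (k : fieldType) (Q : quiver) (d : dimvec Q)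
    (A : rep k d -> Prop) : Prop :=
  (exists X, A X) /\
  forall Z1 Z2 : rep k d -> Prop, zariski_closed Z1 -> zariski_closed Z2 ->
    (forall X, A X -> Z1 X \/ Z2 X) ->
    (forall X, A X -> Z1 X) \/ (forall X, A X -> Z2 X).

Definition in_MQ (k : fieldType) (Q : quiver) (d : dimvec Q)
    (A : rep k d -> Prop) : Prop :=
  [/\ irreducible_set A, zariski_closed A & stable A].

(* The restrictions to A of the functions f`_0, ..., f`_(n-1) are              *)
(* algebraically independent over k in the coordinate ring k[A].               *)
Definition alg_independent_on (k : fieldType) (Q : quiver) (d : dimvec Q)
    (A : rep k d -> Prop) (n : nat) (f : n.-tuple (rep_mpoly k d)) : Prop :=
  forall P : {mpoly k[n]},
    (forall X, A X -> rep_eval (P \mPo f) X = 0) -> P = 0.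

(* The dimension of an irreducible variety A is the transcendence degree over  *)
(* k of its function field k(A).  Since k(A) is generated as a field by k[A],  *)
(* a transcendence basis can be chosen in k[A].                                *)
Definition variety_dim (k : fieldType) (Q : quiver) (d : dimvec Q)
    (A : rep k d -> Prop) : nat :=
  maximum (fun n => exists f : n.-tuple (rep_mpoly k d),
                      alg_independent_on A f).

Definition codim (k : fieldType) (Q : quiver) (d : dimvec Q)
    (A : rep k d -> Prop) : int :=
  (variety_dim (fun _ : rep k d => True))%:Z - (variety_dim A)%:Z.

Definition min_hom (k : fieldType) (Q : quiver) (e d : dimvec Q)
    (B : rep k e -> Prop) (A : rep k d -> Prop) : nat :=
  minimum (fun n => exists (N : rep k e) (M : rep k d),
                      [/\ B N, A M & n = \dim (Hom N M)]).

(* Main.v *)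
Require Import Defs.
From mathcomp Require Import all_boot all_order all_algebra.
From Stdlib Require Import ClassicalEpsilon.
From HB Require Import structures.
From mathcomp Require Import generic_quotient ring_quotient.
From mathcomp Require Import ring zify.

Set Implicit Arguments.
Unset Strict Implicit.
Unset Printing Implicit Defensive.

Import GRing.Theory.
Local Open Scope ring_scope.

(** Every X in A * B contains a copy of some N in B with quotient M in A, so
    after a base change X is block triangular with diagonal blocks M and N and
    an arbitrary off-diagonal block xi.  Base changes in the parabolic subgroup
    of block triangular matrices only move M, N and xi, and unipotent matrices
    1 + nu of the opposite type fill an open set of the remaining directions.
    Hence A * B is, up to closure, the image of the polynomial map

      (M, N, xi, nu)  |->  (1 - nu) (M xi; 0 N) (1 + nu)

    on the irreducible variety Y = A x B x (affine space)
    ([assemble_extension], [extension_dense]).  Comparing dimensions, the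
    codimension of A * B is codim A + codim B - <e, d> + r, where r is the
    dimension of the generic fibre; in particular r >= 0.

    To bound r, differentiate.  A tangent vector (dM, dN, dxi, dnu) of Y killed
    by the differential at (M, N, xi, nu) satisfies N dnu = dnu M, and dnu = 0
    forces the other components to vanish ([assemble_deriv_eq0]).  So the kernel
    at the generic point of Y embeds in the space of homomorphisms from the
    generic N to the generic M, whose dimension is at most that of Hom(N, M) for
    each N in B and M in A, because ranks only drop under specialization
    ([rank_generic_point_ge]).

    It remains to relate dimensions, defined by algebraic independence, to
    ranks of differentials.  Let Y be irreducible with generic point y, a point
    over the function field K.  The generic tangent space T consists of the
    vectors over K killed by the differentials at y of all polynomials vanishing
    on Y.  In characteristic zero polynomial functions on Y are algebraically
    independent if and only if their differentials are linearly independent on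
    T.  Indeed, differentiating an algebraic relation of least degree gives a
    linear relation ([alg_indep_from_duals]); conversely the partial derivatives
    with respect to algebraically independent functions extend to derivations of
    the coordinate ring with values in K, and those are the vectors of T
    ([alg_indep_duals]).  The extension is made one coordinate at a time: the
    minimal polynomial of an algebraic coordinate is separable and prescribes
    its derivative, while a transcendental one may have derivative zero
    ([derivation_extends]).  So the closure of the image of Y under a polynomial
    map has dimension the rank of the differential on T ([image_family_dim]). *)

(** * The residue field of a prime ideal *)

Definition decide (P : Prop) : bool :=
  if excluded_middle_informative P then true else false.

Lemma decideP (P : Prop) : reflect P (decide P).
Proof. by rewrite /decide; case: excluded_middle_informative => h; constructor. Qed.

(** A commutative ring without zero divisors needs an inversion operation on its
    units before its field of fractions can be formed; excluded middle and
    choice supply one. *)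
Lemma domain_embeds_in_field (S : comNzRingType) :
    (forall x y : S, x * y = 0 -> (x == 0) || (y == 0)) ->
  exists (K : fieldType) (f : {rmorphism S -> K}), injective f.
Proof.
move=> dom.
pose unit (x : S) := decide (exists y, y * x = 1).
pose inv (x : S) := if excluded_middle_informative (exists y, y * x = 1) is left h
  then sval (constructive_indefinite_description _ h) else x.
have mulVx : {in unit, left_inverse 1 inv *%R}.
  move=> x /decideP ux; rewrite /inv.
  by case: excluded_middle_informative => // h; case: constructive_indefinite_description.
have unitPl (x y : S) : y * x = 1 -> unit x.
  by move=> h; apply/decideP; exists y.
have invx_out : {in [predC unit], inv =1 id}.
  by move=> x /= /decideP ux; rewrite /inv; case: excluded_middle_informative.
pose SU : comUnitRingType := HB.pack (GRing.ComNzRing.sort S) (GRing.ComNzRing.class S)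
   (GRing.ComNzRing_hasMulInverse.Build S mulVx unitPl invx_out).
pose SD : idomainType := HB.pack (GRing.ComUnitRing.sort SU) (GRing.ComUnitRing.class SU)
   (GRing.ComUnitRing_isIntegral.Build SU dom).
exists {fraction SD}, (@FracField.tofrac SD : {rmorphism SD -> _}).
by move=> x y /eqP; rewrite tofrac_eq => /eqP.
Qed.

Lemma prime_ideal_residue_field (R : comNzRingType) (I : R -> Prop) :
    I 0 -> ~ I 1 -> (forall a u v, I u -> I v -> I (a * u + v)) ->
    (forall u v, I (u * v) -> I u \/ I v) ->
  exists (K : fieldType) (f : {rmorphism R -> K}), forall p, f p = 0 <-> I p.
Proof.
move=> I0 I1 Ilin Iprime; pose J : pred R := fun p => decide (I p).
have JP p : reflect (I p) (p \in J) by apply: decideP.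
have Jideal : idealr_closed J.
  split; [exact/JP | exact/JP | move=> a u v /JP hu /JP hv; exact/JP/Ilin].
have Jprime : prime_idealr_closed J.
  by move=> u v /JP /Iprime [] h; apply/orP; [left | right]; apply/JP.
pose J2 : prime_idealr R := HB.pack J (isIdealr.Build R J Jideal)
  (isPrimeIdealrClosed.Build R J Jprime).
have [K [f finj]] := domain_embeds_in_field (@Quotient.rquot_IdomainAxiom R J2).
pose pi : {rmorphism R -> {ideal_quot J2}} := (\pi_{ideal_quot J2})%qT.
have pi0 p : (pi p == 0) = (p \in J).
  by rewrite -(rmorph0 pi) -[p in RHS]subr0 (Quotient.idealrBE J2).
exists K, (f \o pi : {rmorphism R -> K}) => p /=.
rewrite -(rmorph0 f); split=> [/finj/eqP | /JP hp]; first by rewrite pi0 => /JP.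
by congr (f _); apply/eqP; rewrite pi0.
Qed.

(** * Extending derivations in characteristic zero *)

(** Derivations along [ev]: K is an S-module through [ev]. *)
Definition derivation (S : comNzRingType) (K : fieldType)
    (ev : {rmorphism S -> K}) (D : {additive S -> K}) : Prop :=
  forall a b, D (a * b) = D a * ev b + ev a * D b.

(** For a derivation D along [ev] this says that D comes from a derivation of the
    subring [ev S] of K.  Working with S instead of that subring allows
    elements of K to be adjoined by passing from S to [{poly S}]. *)
Definition factors_through (S : comNzRingType) (K : fieldType)
    (ev : {rmorphism S -> K}) (D : {additive S -> K}) : Prop :=
  forall a, ev a = 0 -> D a = 0.

(** The degree drop in one step of a division. *)
Lemma size_sub_cancel (S : nzRingType) n (p q : {poly S}) :
    (size p <= n.+1)%N -> (size q <= n.+1)%N -> p`_n = q`_n ->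
  (size (p - q)%R <= n)%N.
Proof.
move=> sp sq e; apply/leq_sizeP => j; rewrite leq_eqVlt => /predU1P [<- | lt].
  by rewrite coefB e subrr.
by rewrite coefB !nth_default ?subrr // (leq_trans _ lt).
Qed.

Section SimpleExtension.
Variables (S : comNzRingType) (K : fieldType).
Variables (ev : {rmorphism S -> K}) (D : {additive S -> K}) (x w : K).

(** The adjunction of x to the subring [ev S] of K. *)
Definition eval_adjoin : {poly S} -> K := horner_eval x \o map_poly ev.

HB.instance Definition _ := GRing.RMorphism.on eval_adjoin.

(** The derivation along [eval_adjoin] that extends D and takes the value w at
    x. *)
Definition deriv_adjoin (p : {poly S}) : K := (map_poly D p).[x] + eval_adjoin p^`() * w.

Lemma deriv_adjoin_is_additive : zmod_morphism deriv_adjoin.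
Proof.
move=> p q; rewrite /deriv_adjoin raddfB hornerD hornerN derivB rmorphB /=; ring.
Qed.

HB.instance Definition _ :=
  GRing.isZmodMorphism.Build {poly S} K deriv_adjoin deriv_adjoin_is_additive.

Lemma eval_adjoinC a : eval_adjoin a%:P = ev a.
Proof. by rewrite /eval_adjoin /= map_polyC /horner_eval hornerC. Qed.

Lemma eval_adjoinX : eval_adjoin 'X = x.
Proof. by rewrite /eval_adjoin /= map_polyX /horner_eval hornerX. Qed.

Lemma deriv_adjoinC a : deriv_adjoin a%:P = D a.
Proof. by rewrite /deriv_adjoin derivC rmorph0 mul0r addr0 map_polyC hornerC. Qed.

Lemma deriv_adjoin_derivation : derivation ev D -> derivation eval_adjoin deriv_adjoin.
Proof.
move=> dD p q.
have mapM : map_poly D (p * q) =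
    map_poly D p * map_poly ev q + map_poly ev p * map_poly D q.
  apply/polyP => n; rewrite coef_map coefD !coefM raddf_sum -big_split /=.
  by apply: eq_bigr => i _; rewrite !coef_map dD.
rewrite /= /deriv_adjoin mapM derivM hornerD !hornerM rmorphD !rmorphM /=.
rewrite /eval_adjoin /= /horner_eval; ring.
Qed.

Hypothesis dD : derivation ev D.
Hypothesis kerD : factors_through ev D.

(** Without relations on x only relations between coefficients have to be
    respected, and D does so already. *)
Lemma deriv_adjoin_transcendental :
    (forall p, eval_adjoin p = 0 -> map_poly ev p = 0) -> w = 0 ->
  factors_through eval_adjoin deriv_adjoin.
Proof.
move=> tr w0 p /tr p0; rewrite /= /deriv_adjoin w0 mulr0 addr0.
suff -> : map_poly D p = 0 by rewrite horner0.
apply/polyP => i; rewrite coef_map coef0 kerD //.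
by rewrite -(coef_map ev) p0 coef0.
Qed.

(** Here q plays the role of the minimal polynomial of x.  A relation p of x is
    reduced either by dropping a leading term that is zero in K, or by a
    pseudo-division step by q; neither step changes whether the derivation
    vanishes on p. *)
Lemma deriv_adjoin_algebraic (q : {poly S}) :
    ev (lead_coef q) != 0 -> eval_adjoin q = 0 -> deriv_adjoin q = 0 ->
    (forall p, ev (lead_coef p) != 0 -> eval_adjoin p = 0 -> (size q <= size p)%N) ->
  factors_through eval_adjoin deriv_adjoin.
Proof.
move=> lq q0 Dq minq p; have [n] := ubnP (size p).
elim: n p => // n IH p; rewrite ltnS leq_eqVlt => /predU1P [sp | ]; last exact: IH.
move=> p0; have dD_adjoin := deriv_adjoin_derivation dD.
case: n IH sp => [| n] IH sp.
  by move/eqP: sp; rewrite size_poly_eq0 => /eqP ->; rewrite raddf0.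
have pn : p`_n = lead_coef p by rewrite /lead_coef sp.
have [lp0 | lpN0] := eqVneq (ev (lead_coef p)) 0.
  pose r := (lead_coef p)%:P * 'X^n.
  have r0 : eval_adjoin r = 0 by rewrite rmorphM /= eval_adjoinC lp0 mul0r.
  have Dr : deriv_adjoin r = 0.
    by rewrite /r dD_adjoin /= eval_adjoinC deriv_adjoinC lp0 (kerD lp0) !mul0r addr0.
  rewrite -[p](subrK r) raddfD /= Dr addr0; apply: IH; last first.
    by rewrite rmorphB /= p0 r0 subrr.
  rewrite ltnS; apply: size_sub_cancel; rewrite ?sp //.
    by rewrite /r mul_polyC (leq_trans (size_scale_leq _ _)) // size_polyXn.
  by rewrite /r coefCM coefXn eqxx mulr1.
have leqp := minq p lpN0 p0; rewrite sp in leqp.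
have qN0 : q != 0 by apply: contraNneq lq => ->; rewrite lead_coef0 rmorph0.
have q_gt0 : (0 < size q)%N by rewrite size_poly_gt0.
(* One step of pseudo-division of p by q; lead_coef q may fail to be a unit in S. *)
pose r := (lead_coef p)%:P * 'X^(n.+1 - size q) * q.
have arith (s m : nat) : (0 < s)%N -> (s <= m.+1)%N ->
  (m < m.+1 - s)%N = false /\ (m - (m.+1 - s))%N = s.-1 by lia.
have r0 : eval_adjoin r = 0 by rewrite rmorphM /= q0 mulr0.
have Dr : deriv_adjoin r = 0 by rewrite /r dD_adjoin /= q0 Dq !mulr0 addr0.
have : deriv_adjoin ((lead_coef q)%:P * p - r) = 0.
  apply: IH; last by rewrite rmorphB /= r0 rmorphM /= p0 mulr0 subr0.
  rewrite ltnS; apply: size_sub_cancel.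
  - by rewrite mul_polyC (leq_trans (size_scale_leq _ _)) ?sp.
  - rewrite /r -mulrA mul_polyC (leq_trans (size_scale_leq _ _)) //.
    by rewrite (leq_trans (size_polyMleq _ _)) // size_polyXn addSn /= subnK.
  rewrite coefCM /r -mulrA coefCM coefXnM pn.
  have [-> ->] := arith _ _ q_gt0 leqp; exact: mulrC.
rewrite raddfB /= Dr subr0 dD_adjoin /= p0 mulr0 add0r eval_adjoinC.
by move/eqP; rewrite mulf_eq0 (negbTE lq) => /eqP.
Qed.

End SimpleExtension.

(** Source of the minimal polynomial in [derivation_extends]. *)
Lemma poly_of_least_size (S : nzRingType) (P : {poly S} -> Prop) :
  (exists p, P p) -> exists2 q, P q & forall p, P p -> (size q <= size p)%N.
Proof.
case=> p; have [n] := ubnP (size p); elim: n p => // n IH p ltpn Pp.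
case: (excluded_middle_informative (exists2 q, P q & (size q < size p)%N)).
  by case=> q Pq ltqp; apply: (IH q) => //; rewrite (leq_trans ltqp).
move=> none; exists p => // q Pq; rewrite leqNgt; apply/negP => lt.
by apply: none; exists q.
Qed.

(** A relation with coefficients in [ev S] lifts to S with a leading coefficient
    that stays nonzero in K, so that degrees before and after [ev] agree. *)
Lemma map_poly_trim (S : nzRingType) (K : fieldType) (ev : {rmorphism S -> K})
    (p : {poly S}) :
  map_poly ev p != 0 ->
  exists2 q, ev (lead_coef q) != 0 & map_poly ev q = map_poly ev p.
Proof.
move=> p0; pose n := size (map_poly ev p); pose q := \poly_(i < n) p`_i.
have eq : map_poly ev q = map_poly ev p.
  apply/polyP => i; rewrite !coef_map coef_poly; case: ltnP => // h.
  by rewrite raddf0 -coef_map nth_default.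
have sq : size q = n.
  apply/eqP; rewrite eqn_leq size_poly /= /n -eq; apply/leq_sizeP => i h.
  by rewrite coef_map nth_default ?raddf0.
by exists q => //; rewrite /lead_coef sq -coef_map eq -lead_coefE lead_coef_eq0.
Qed.

(** Differentiating the minimal relation q(x) = 0 forces q'(x) w = - (D q)(x).
    In characteristic zero q' has a nonzero leading coefficient and smaller
    degree, so minimality of q makes q'(x) invertible. *)
Lemma derivation_extends (S : comNzRingType) (K : fieldType)
    (ev : {rmorphism S -> K}) (D : {additive S -> K}) (x : K) :
    [pchar K] =i pred0 -> derivation ev D -> factors_through ev D ->
  exists w, factors_through (eval_adjoin ev x) (deriv_adjoin ev D x w).
Proof.
move=> char0 dD kerD.
case: (excluded_middle_informative
         (exists p, ev (lead_coef p) != 0 /\ eval_adjoin ev x p = 0)); last first.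
  move=> tr; exists 0; apply: deriv_adjoin_transcendental => // p p0.
  apply/eqP/negPn/negP => /map_poly_trim [q lq eq]; apply: tr.
  by exists q; split=> //; rewrite /eval_adjoin /= eq.
case/poly_of_least_size => q [lq q0] minq.
have dqN0 : eval_adjoin ev x q^`() != 0.
  apply/eqP => dq0.
  have [sq | [n sq]] : (size q <= 1)%N \/ exists n, size q = n.+2.
      by case: (size q) => [|[|n]]; [left | left | right; exists n].
    move: lq q0; rewrite (size1_polyC sq) eval_adjoinC lead_coefC => /eqP; exact.
  have cN0 : ev (q^`()`_n) != 0.
    rewrite coef_deriv rmorphMn /= -mulr_natr mulf_neq0 //.
      by move: lq; rewrite /lead_coef sq.
    by rewrite ((pcharf0P K).1 char0).
  have sd : size q^`() = n.+1.
    apply/eqP; rewrite eqn_leq; apply/andP; split.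
      by have := lt_size_deriv (p := q); rewrite -size_poly_gt0 sq ltnS; apply.
    rewrite ltnNge; apply: contra cN0 => h.
    by rewrite nth_default ?rmorph0.
  have := minq q^`(); rewrite sq sd /lead_coef sd /= => /(_ (conj cN0 dq0)).
  by rewrite ltnn.
exists (- (map_poly D q).[x] / eval_adjoin ev x q^`()).
apply: (@deriv_adjoin_algebraic _ _ _ _ _ _ _ _ q) => //.
  by rewrite /= /deriv_adjoin mulrC divfK ?addrN.
by move=> p lp p0; apply: minq; split.
Qed.

Lemma derivation_extends_seq (K : fieldType) (xs : seq K)
    (S : comNzRingType) (ev : {rmorphism S -> K}) (D : {additive S -> K}) :
    [pchar K] =i pred0 -> derivation ev D -> factors_through ev D ->
  exists (S' : comNzRingType) (iota : {rmorphism S -> S'})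
         (ev' : {rmorphism S' -> K}) (D' : {additive S' -> K}),
    [/\ derivation ev' D', factors_through ev' D',
        forall a, ev' (iota a) = ev a, forall a, D' (iota a) = D a
      & forall x, x \in xs -> exists X, ev' X = x].
Proof.
move=> char0; elim: xs S ev D => [|x xs IH] S ev D dD kerD.
  by exists S, idfun, ev, D; split.
have [w ker_adjoin] := derivation_extends x char0 dD kerD.
have [S' [iota [ev' [D' [dD' kerD' eviota Diota surj]]]]] :=
  IH _ _ _ (deriv_adjoin_derivation x w dD) ker_adjoin.
exists S', (iota \o polyC : {rmorphism S -> S'}), ev', D'; split=> //=.
- by move=> a; rewrite eviota /= eval_adjoinC.
- by move=> a; rewrite Diota /= deriv_adjoinC.
move=> y; rewrite inE => /predU1P [-> | /surj //].
by exists (iota 'X); rewrite eviota /= eval_adjoinX.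
Qed.

(** * Polynomials at a point of a field extension *)

(** Polynomials are generated as a ring by constants and variables. *)
Lemma mpoly_ring_ind (R : comNzRingType) (n : nat) (P : {mpoly R[n]} -> Prop) :
    (forall a, P a%:MP) -> (forall i, P 'X_i) ->
    (forall p q, P p -> P q -> P (p + q)) -> (forall p q, P p -> P q -> P (p * q)) ->
  forall p, P p.
Proof.
move=> Pc PX PD PM; elim/mpolyind => [|a m p _ _ Pp].
  by rewrite -mpolyC0; apply: (Pc).
apply: (PD) => //; rewrite -mul_mpolyC; apply: (PM) => //.
rewrite mpolyXE_id; elim/big_rec: _ => [|i q _ Pq]; first by rewrite -mpolyC1; apply: (Pc).
apply: (PM) => //; elim: (m i) => [|j IH]; first by rewrite expr0 -mpolyC1; apply: (Pc).
by rewrite exprS; apply: (PM).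
Qed.

Lemma mpoly_rmorph_ext (R S : comNzRingType) (n : nat)
    (f g : {rmorphism {mpoly R[n]} -> S}) :
  (forall a, f a%:MP = g a%:MP) -> (forall i, f 'X_i = g 'X_i) -> f =1 g.
Proof.
move=> eC eX; elim/mpoly_ring_ind => // p q ep eq.
  by rewrite !rmorphD ep eq.
by rewrite !rmorphM ep eq.
Qed.

Section Gradient.
Variables (k K : fieldType) (c : {rmorphism k -> K}).

Definition evalK (N : nat) (y : 'rV[K]_N) : {mpoly k[N]} -> K := mmap c (y 0).

HB.instance Definition _ N y := GRing.RMorphism.on (@evalK N y).

Lemma evalKC N (y : 'rV[K]_N) a : evalK y a%:MP = c a.
Proof. exact: mmapC. Qed.

Lemma evalKX N (y : 'rV[K]_N) i : evalK y 'X_i = y 0 i.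
Proof. by rewrite /evalK mmapX mmap1U. Qed.

(** The directional derivative at y along v. *)
Definition dderiv (N : nat) (y v : 'rV[K]_N) (p : {mpoly k[N]}) : K :=
  \sum_i v 0 i * evalK y (mderiv i p).

Lemma dderiv_is_additive N (y v : 'rV[K]_N) : zmod_morphism (dderiv y v).
Proof.
move=> p q; rewrite /dderiv -sumrB; apply: eq_bigr => i _.
by rewrite !raddfB /= mulrBr.
Qed.

HB.instance Definition _ N y v :=
  GRing.isZmodMorphism.Build {mpoly k[N]} K (@dderiv N y v) (@dderiv_is_additive N y v).

Lemma dderiv_derivation N (y v : 'rV[K]_N) : derivation (@evalK N y) (@dderiv N y v).
Proof.
move=> p q /=; rewrite /dderiv mulr_suml mulr_sumr -big_split /=.
by apply: eq_bigr => i _; rewrite mderivM rmorphD !rmorphM /=; ring.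
Qed.

Lemma dderivC N (y v : 'rV[K]_N) a : dderiv y v a%:MP = 0.
Proof. by rewrite /dderiv big1 // => i _; rewrite mderivC rmorph0 mulr0. Qed.

Lemma dderivX N (y v : 'rV[K]_N) i : dderiv y v 'X_i = v 0 i.
Proof.
rewrite /dderiv (bigD1 i) //= big1 => [|j ji].
  rewrite mderivX mnm1E eqxx -[X in (X - _)%MM]add0m addmK mpolyX0.
  by rewrite scale1r rmorph1 mulr1 addr0.
by rewrite mderivX mnm1E eq_sym (negbTE ji) scale0r rmorph0 mulr0.
Qed.

Lemma dderiv_linear N (y : 'rV[K]_N) a u v p :
  dderiv y (a *: u + v) p = a * dderiv y u p + dderiv y v p.
Proof.
rewrite /dderiv mulr_sumr -big_split /=; apply: eq_bigr => i _.
by rewrite !mxE; ring.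
Qed.

Lemma dderiv0 N (y : 'rV[K]_N) p : dderiv y 0 p = 0.
Proof. by rewrite /dderiv big1 // => i _; rewrite mxE mul0r. Qed.

(** A k-linear derivation of a polynomial ring is determined by its values on the
    variables: derivations along [evalK c y] are tangent vectors at y. *)
Lemma dderiv_unique N (y : 'rV[K]_N) (D : {additive {mpoly k[N]} -> K}) :
    derivation (@evalK N y) D -> (forall a, D a%:MP = 0) ->
  D =1 dderiv y (\row_i D 'X_i).
Proof.
move=> dD DC; elim/mpoly_ring_ind => [a | i | p q ep eq | p q ep eq].
- by rewrite DC dderivC.
- by rewrite dderivX mxE.
- by rewrite !raddfD ep eq.
- by rewrite dD ep eq dderiv_derivation.
Qed.

(** Pullback along the polynomial map phi, that is, substitution of the entries
    of phi for the variables. *)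
Definition pull (M N : nat) (phi : 'rV[{mpoly k[N]}]_M) : {mpoly k[M]} -> {mpoly k[N]} :=
  mmap (@mpolyC N k) (phi 0).

HB.instance Definition _ M N phi := GRing.RMorphism.on (@pull M N phi).

Lemma pullC M N (phi : 'rV[{mpoly k[N]}]_M) a : pull phi a%:MP = a%:MP.
Proof. exact: mmapC. Qed.

Lemma pullX M N (phi : 'rV[{mpoly k[N]}]_M) i : pull phi 'X_i = phi 0 i.
Proof. by rewrite /pull mmapX mmap1U. Qed.

Lemma evalK_pull M N (phi : 'rV[{mpoly k[N]}]_M) (y : 'rV[K]_N) p :
  evalK y (pull phi p) = evalK (map_mx (evalK y) phi) p.
Proof.
rewrite -[LHS]/((evalK y \o pull phi) p).
apply: (@mpoly_rmorph_ext k K M) p => [a | i] /=; first by rewrite pullC !evalKC.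
by rewrite pullX evalKX mxE.
Qed.

Definition jacobian M N (phi : 'rV[{mpoly k[N]}]_M) (y : 'rV[K]_N) : 'M[K]_(N, M) :=
  \matrix_(i, j) evalK y (mderiv i (phi 0 j)).

Lemma mul_jacobian M N (phi : 'rV[{mpoly k[N]}]_M) (y v : 'rV[K]_N) :
  v *m jacobian phi y = map_mx (dderiv y v) phi.
Proof. by apply/rowP => j; rewrite !mxE /dderiv; apply: eq_bigr => i _; rewrite mxE. Qed.

Lemma chain_rule M N (phi : 'rV[{mpoly k[N]}]_M) (y v : 'rV[K]_N) p :
  dderiv y v (pull phi p) = dderiv (map_mx (evalK y) phi) (v *m jacobian phi y) p.
Proof.
rewrite -[LHS]/((dderiv y v \o pull phi) p).
rewrite (@dderiv_unique M (map_mx (evalK y) phi)) /=.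
- congr (dderiv _ _ p); rewrite mul_jacobian.
  by apply/rowP => j; rewrite !mxE /= pullX.
- by move=> a b /=; rewrite rmorphM dderiv_derivation /= !evalK_pull.
by move=> a; rewrite /= pullC dderivC.
Qed.

Lemma dderiv_pull M N (phi : 'rV[{mpoly k[N]}]_M) (y v : 'rV[K]_N) p :
  dderiv y v (pull phi p) =
    \sum_l dderiv y v (phi 0 l) * evalK y (pull phi (mderiv l p)).
Proof.
rewrite chain_rule mul_jacobian [LHS]/dderiv; apply: eq_bigr => l _.
by rewrite mxE evalK_pull.
Qed.

End Gradient.

(** * Generic tangent spaces and dimension *)

(** A family of points x parametrizes a subset of affine space; all geometry
    below depends only on the ideal of polynomials vanishing on that subset.
    Parametrized families make products and images immediate. *)
Definition vanishes (k : fieldType) (T : Type) (N : nat) (x : T -> 'rV[k]_N)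
  (p : {mpoly k[N]}) : Prop := forall t, p.@[x t 0] = 0.

Definition irreducible_family (k : fieldType) (T : Type) (N : nat) (x : T -> 'rV[k]_N) :=
  inhabited T /\ forall p q, vanishes x (p * q) -> vanishes x p \/ vanishes x q.

Definition generic_point (k K : fieldType) (c : {rmorphism k -> K}) (T : Type) (N : nat)
  (x : T -> 'rV[k]_N) (y : 'rV[K]_N) : Prop :=
  forall p, evalK c y p = 0 <-> vanishes x p.

Definition alg_indep (k : fieldType) (T : Type) (N : nat) (x : T -> 'rV[k]_N)
  (n : nat) (f : 'rV[{mpoly k[N]}]_n) : Prop :=
  forall P, vanishes x (pull f P) -> P = 0.

Definition image_family (k : fieldType) (T : Type) (N M : nat) (phi : 'rV[{mpoly k[N]}]_M)
    (x : T -> 'rV[k]_N) (t : T) : 'rV[k]_M :=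
  map_mx (meval (x t 0)) phi.

(** The coordinate functions, as elements of the function field, form the generic
    point. *)
Lemma generic_point_exists (k : fieldType) (T : Type) (N : nat) (x : T -> 'rV[k]_N) :
    irreducible_family x ->
  exists (K : fieldType) (c : {rmorphism k -> K}) (y : 'rV[K]_N), generic_point c x y.
Proof.
case=> [[t0]] xprime.
have [|||K [f fP]] := @prime_ideal_residue_field _ (vanishes x) _ _ _ xprime.
- by move=> t; rewrite meval0.
- by move=> /(_ t0); rewrite meval1 => /eqP; rewrite oner_eq0.
- by move=> a u v u0 v0 t; rewrite mevalD mevalM u0 v0 mulr0 addr0.
pose c : {rmorphism k -> K} := f \o (@mpolyC N k).
exists K, c, (\row_i f 'X_i) => p; rewrite -fP.
suff -> : evalK c (\row_i f 'X_i) p = f p by [].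
apply: (@mpoly_rmorph_ext k K N) => [a | i] /=; first by rewrite evalKC.
by rewrite evalKX mxE.
Qed.

Lemma pchar_rmorph (k K : fieldType) (c : {rmorphism k -> K}) :
  [pchar k] =i pred0 -> [pchar K] =i pred0.
Proof. by move=> h p; rewrite (fmorph_pchar c) h. Qed.

Lemma pull_meval (k : fieldType) M N (phi : 'rV[{mpoly k[N]}]_M) (x : 'rV[k]_N) p :
  (pull phi p).@[x 0] = p.@[map_mx (meval (x 0)) phi 0].
Proof.
have := @evalK_pull k k idfun M N phi x p; rewrite /evalK /meval => ->.
by congr (mmap _ _ p).
Qed.

Lemma pull_pull (k : fieldType) L M N (g : 'rV[{mpoly k[M]}]_L) (phi : 'rV[{mpoly k[N]}]_M) p :
  pull phi (pull g p) = pull (map_mx (pull phi) g) p.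
Proof.
rewrite -[LHS]/((pull phi \o pull g) p).
apply: (@mpoly_rmorph_ext k _ L) p => [a | i] /=; first by rewrite !pullC.
by rewrite !pullX mxE.
Qed.

Lemma vanishes_image (k : fieldType) (T : Type) (N M : nat) (phi : 'rV[{mpoly k[N]}]_M)
    (x : T -> 'rV[k]_N) p :
  vanishes (image_family phi x) p <-> vanishes x (pull phi p).
Proof. by split=> h t; have := h t; rewrite pull_meval. Qed.

Lemma alg_indep_image (k : fieldType) (T : Type) (N M n : nat) (phi : 'rV[{mpoly k[N]}]_M)
    (x : T -> 'rV[k]_N) (g : 'rV[{mpoly k[M]}]_n) :
  alg_indep (image_family phi x) g <-> alg_indep x (map_mx (pull phi) g).
Proof.
by split=> h P v; apply: h; move: v; rewrite vanishes_image pull_pull.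
Qed.

Lemma msize_mderiv_lt (R : nzRingType) n (P : {mpoly R[n]}) j :
  P != 0 -> (msize (mderiv j P) < msize P)%N.
Proof.
rewrite -msize_poly_eq0 -lt0n => P0; rewrite msizeE big_seq_cond.
rewrite -[msize P]prednK // ltnS; apply: (big_ind (fun m => m <= (msize P).-1)%N) => //.
  by move=> a b ha hb; rewrite geq_max ha.
move=> m; rewrite andbT mcoeff_msupp mcoeff_deriv => m0.
have /msize_mdeg_lt : (m + U_(j))%MM \in msupp P.
  by rewrite mcoeff_msupp; apply: contraNneq m0 => ->; rewrite mul0rn.
rewrite mdegD mdeg1; lia.
Qed.

(** Fails in positive characteristic p, where p-th powers have zero gradient. *)
Lemma mderiv_eq0_const (k : fieldType) n (P : {mpoly k[n]}) :
  [pchar k] =i pred0 -> (forall j, mderiv j P = 0) -> P = (P@_0)%:MP.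
Proof.
move=> char0 dP; apply/mpolyP => m; rewrite mcoeffC.
have [<- | m0] := eqVneq 0%MM m; first by rewrite mulr1.
have [j mj] : exists j, m j != 0%N.
  apply/existsP; apply: contraNT m0; rewrite negb_exists => /forallP h.
  by apply/eqP/mnmP => j; rewrite mnm0E; apply/esym/eqP/negPn/h.
rewrite mulr0; have /eqP : (mderiv j P)@_(m - U_(j)) = 0 by rewrite dP mcoeff0.
rewrite mcoeff_deriv submK; last by rewrite lep1mP.
by rewrite -mulr_natr mulf_eq0 ((pcharf0P k).1 char0) orbF => /eqP.
Qed.

Section Tangent.
Variables (k K : fieldType) (c : {rmorphism k -> K}).
Variables (T : Type) (N : nat) (x : T -> 'rV[k]_N) (y : 'rV[K]_N).
Hypotheses (char0 : [pchar k] =i pred0) (ygen : generic_point c x y).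

(** The Zariski tangent space at y, by equations. *)
Definition tangent (v : 'rV[K]_N) : Prop :=
  forall p, vanishes x p -> dderiv c y v p = 0.

Definition tangent_space (m : nat) (V : 'M[K]_(m, N)) : Prop :=
  forall v : 'rV[K]_N, (v <= V)%MS <-> tangent v.

(** The partial derivative with respect to f_j, on the polynomial ring in
    algebraically independent f, extends to all coordinates by
    [derivation_extends_seq]; its values there form a tangent vector. *)
Lemma alg_indep_duals (n : nat) (f : 'rV[{mpoly k[N]}]_n) :
    alg_indep x f ->
  forall j, exists2 v, tangent v & forall l, dderiv c y v (f 0 l) = (j == l)%:R.
Proof.
move=> findep j; pose z : 'rV[K]_n := map_mx (evalK c y) f.
pose e : 'rV[K]_n := delta_mx 0 j.
have kerD : factors_through (evalK c z) (dderiv c z e).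
  move=> P P0; rewrite (findep P) ?raddf0 //.
  by apply/ygen; rewrite evalK_pull.
have [S [iota [ev [D [dD kerD' eviota Diota surj]]]]] :=
  derivation_extends_seq [seq y 0 i | i : 'I_N] (pchar_rmorph c char0)
    (dderiv_derivation c z e) kerD.
have {}eviota P : ev (iota P) = evalK c z P := eviota P.
have {}Diota P : D (iota P) = dderiv c z e P := Diota P.
(* The derivation lives on S; the polynomial ring in the coordinates of y maps
   to S by lifting them. *)
have lift i : {X | ev X = y 0 i}.
  apply: constructive_indefinite_description; apply: surj.
  by apply/mapP; exists i => //; rewrite mem_enum.
pose X i := sval (lift i); have evX i : ev (X i) = y 0 i := svalP (lift i).
pose h : {rmorphism {mpoly k[N]} -> S} := mmap (iota \o @mpolyC n k) X.
have hC a : h a%:MP = iota a%:MP by rewrite /h /= mmapC.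
have hX i : h 'X_i = X i by rewrite /h /= mmapX mmap1U.
have evh p : ev (h p) = evalK c y p.
  rewrite -[LHS]/((ev \o h) p).
  apply: (@mpoly_rmorph_ext k K N) p => [a | i] /=; last by rewrite hX evX evalKX.
  by rewrite hC eviota !evalKC.
have Dh p : D (h p) = dderiv c y (\row_i D (X i)) p.
  rewrite -[LHS]/((D \o h) p) (@dderiv_unique _ _ c N y) /=.
  - by congr (dderiv _ _ _ p); apply/rowP => i; rewrite !mxE /= hX.
  - by move=> p1 p2; rewrite /= rmorphM dD !evh.
  by move=> a; rewrite /= hC Diota dderivC.
exists (\row_i D (X i)) => [p p0 | l].
  by rewrite -Dh kerD' // evh; apply/ygen.
rewrite -Dh (_ : D (h (f 0 l)) = D (iota 'X_l)).
  by rewrite Diota dderivX mxE eqxx eq_sym.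
apply/eqP; rewrite -subr_eq0 -raddfB kerD' // rmorphB /=.
by rewrite evh eviota evalKX mxE subrr.
Qed.

(** Applying the dual tangent vectors to a relation P(f) = 0 of least degree shows
    that all partial derivatives of P are relations too, of smaller degree.
    Hence they vanish and P is constant. *)
Lemma alg_indep_from_duals (n : nat) (f : 'rV[{mpoly k[N]}]_n) :
    inhabited T ->
    (forall j, exists2 v, tangent v & forall l, dderiv c y v (f 0 l) = (j == l)%:R) ->
  alg_indep x f.
Proof.
case=> t0 duals P; have [m] := ubnP (msize P).
elim: m P => // m IH P ltPm P0.
have dP0 j : mderiv j P = 0.
  have [v vtan vf] := duals j.
  have [msz|msz] := leqP (msize P) 1.
    by rewrite (msize1_polyC msz) mderivC.
  apply: IH.
    rewrite -ltnS; apply: leq_trans ltPm; apply: msize_mderiv_lt.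
    by rewrite -msize_poly_eq0 -lt0n ltnW.
  apply/ygen; have := vtan _ P0.
  rewrite dderiv_pull (bigD1 j) //= big1 ?addr0 => [|l lj].
    by rewrite vf eqxx mul1r.
  by rewrite vf eq_sym (negbTE lj) mul0r.
have PC : P = (P@_0)%:MP by apply: mderiv_eq0_const.
have := P0 t0; rewrite PC pullC mevalC => ->; exact: mpolyC0.
Qed.

(** The differentials of n algebraically independent functions of the image are
    independent linear forms on the image of the tangent space. *)
Lemma image_dim_le (M : nat) (phi : 'rV[{mpoly k[N]}]_M) m (V : 'M[K]_(m, N))
    n (g : 'rV[{mpoly k[M]}]_n) :
    tangent_space V ->
    alg_indep (image_family phi x) g -> (n <= \rank (V *m jacobian c phi y))%N.
Proof.
move=> tanV /alg_indep_image /alg_indep_duals duals.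
have dualV j : {v | (v <= V)%MS /\ forall l, dderiv c y v (pull phi (g 0 l)) = (j == l)%:R}.
  apply: constructive_indefinite_description.
  have [v vtan vf] := duals j; exists v; split; first exact/tanV.
  by move=> l; rewrite -vf mxE.
pose W := \matrix_j sval (dualV j).
have WV : (W <= V)%MS by apply/row_subP => j; rewrite rowK; case: (svalP (dualV j)).
pose z := map_mx (evalK c y) phi.
pose G := jacobian c g z.
have WJG : W *m jacobian c phi y *m G = 1%:M.
  apply/row_matrixP => j; rewrite !row_mul rowK.
  case: (svalP (dualV j)) => _ dual; apply/rowP => l.
  by rewrite /G (mul_jacobian c g z) mxE -chain_rule dual !mxE.
apply: leq_trans (mxrankS (submxMr _ WV)).
rewrite -[X in (X <= _)%N](mxrank1 K) -WJG; exact: mxrankM_maxl.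
Qed.

(** Choosing coordinates of the target that realize the rank of the differential
    gives functions with dual tangent vectors. *)
Lemma image_dim_ge (M : nat) (phi : 'rV[{mpoly k[N]}]_M) m (V : 'M[K]_(m, N)) :
    inhabited T -> tangent_space V ->
  exists n (g : 'rV[{mpoly k[M]}]_n),
    \rank (V *m jacobian c phi y) = n /\ alg_indep (image_family phi x) g.
Proof.
move=> Tne tanV; set U := V *m _.
pose f := maxrankfun U^T.
exists (\rank U^T), (\row_l 'X_(f l)); split; first by rewrite mxrank_tr.
apply/alg_indep_image/alg_indep_from_duals => // j.
have /row_fullP [L LU] : row_full (colsub f U).
  by rewrite /row_full -mxrank_tr trmx_mxsub; apply: maxrowsub_free.
exists (row j L *m V); first by apply/tanV; rewrite submxMl.
move=> l; transitivity ((row j L *m V *m jacobian c phi y) 0 (f l)).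
  by rewrite mul_jacobian !mxE pullX.
have : (row j L *m colsub f U) 0 l = (j == l)%:R by rewrite -row_mul LU !mxE.
by rewrite mulmx_colsub -mulmxA mxE.
Qed.

End Tangent.

(** A subspace of a finite dimensional space given by arbitrarily many equations
    is the row space of a matrix: enlarge one as long as possible. *)
Lemma tangent_space_exists (k K : fieldType) (c : {rmorphism k -> K})
  (T : Type) (N : nat) (x : T -> 'rV[k]_N) (y : 'rV[K]_N) :
  exists V : 'M[K]_N, tangent_space c x y V.
Proof.
suff: forall n (W : 'M[K]_N), (N - \rank W <= n)%N ->
   (forall v, (v <= W)%MS -> tangent c x y v) ->
   exists V : 'M[K]_N, tangent_space c x y V.
  move=> /(_ N 0); rewrite mxrank0 subn0; apply=> // v; rewrite submx0 => /eqP -> p _.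
  by rewrite /dderiv big1 // => i _; rewrite mxE mul0r.
elim=> [|n IH] W rW Wtan.
  exists W => v; split; first exact: Wtan.
  move=> _; apply: submx_full; rewrite /row_full eqn_leq rank_leq_row.
  by move: rW; rewrite leqn0 subn_eq0.
case: (excluded_middle_informative (exists2 v, tangent c x y v & ~~ (v <= W)%MS)); last first.
  move=> none; exists W => v; split; first exact: Wtan.
  by move=> vtan; apply/negPn/negP => h; apply: none; exists v.
case=> v vtan vW; apply: (IH (W + v)%MS).
  suff : (\rank W < \rank (W + v)%MS)%N by move: rW; lia.
  apply: rank_ltmx; rewrite ltmxE addsmxSl.
  by apply: contra vW; apply: submx_trans; rewrite addsmxSr.
move=> u /sub_addsmxP [[a b] /= ->] p p0.
rewrite -[a *m W]scale1r dderiv_linear Wtan ?submxMl // mulr0 add0r.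
by rewrite [b]mx11_scalar mul_scalar_mx -[_ *: v]addr0 dderiv_linear vtan // mulr0 add0r dderiv0.
Qed.

(** * Affine spaces and products *)

Lemma poly_vanishes_everywhere (k : fieldType) (q : {poly k}) :
  [pchar k] =i pred0 -> (forall t, q.[t] = 0) -> q = 0.
Proof.
move=> char0 q0; apply/eqP/negPn/negP => qN0.
pose rs : seq k := [seq (i%:R : k) | i <- iota 0 (size q)].
have rs_roots : all (root q) rs by apply/allP => t _; apply/eqP.
suff rs_uniq : uniq rs.
  by have := max_poly_roots qN0 rs_roots rs_uniq; rewrite size_map size_iota ltnn.
rewrite map_inj_uniq ?iota_uniq // => i j /eqP.
wlog le : i j / (i <= j)%N.
  move=> h; case: (leqP i j) => [|/ltnW] le e; first exact: h.
  by apply/esym/h; rewrite // eq_sym.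
rewrite eq_sym -subr_eq0 -natrB // ((pcharf0P k).1 char0) subn_eq0 => le'.
by apply/eqP; rewrite eqn_leq le le'.
Qed.

(** Restriction to lines shows that the partial derivatives vanish everywhere as
    well; they have smaller degree. *)
Lemma mpoly_vanishes_everywhere (k : fieldType) n (p : {mpoly k[n]}) :
  [pchar k] =i pred0 -> (forall v : 'rV[k]_n, p.@[v 0] = 0) -> p = 0.
Proof.
move=> char0; have [m] := ubnP (msize p); elim: m p => // m IH p ltpm p0.
have [-> // | pN0] := eqVneq p 0.
have dp0 j : mderiv j p = 0.
  apply: IH => [|v]; first by have := msize_mderiv_lt j pN0; lia.
  pose line : {rmorphism {mpoly k[n]} -> {poly k}} :=
    mmap (@polyC k) (fun i => (v 0 i)%:P + (j == i)%:R *: 'X).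
  have lineC a : line a%:MP = a%:P by rewrite /= mmapC.
  have lineX i : line 'X_i = (v 0 i)%:P + (j == i)%:R *: 'X by rewrite /= mmapX mmap1U.
  have line_eval t q : (line q).[t] = q.@[(v + t *: delta_mx 0 j) 0].
    rewrite -[LHS]/((horner_eval t \o line) q).
    apply: (@mpoly_rmorph_ext k k n) q => [a | i] /=; rewrite /horner_eval.
      by rewrite lineC hornerC mevalC.
    by rewrite lineX mevalXU !hornerE !mxE eqxx eq_sym mulrC.
  have line0 : line p = 0.
    by apply: poly_vanishes_everywhere => // t; rewrite line_eval p0.
  have line_deriv q : (line q)^`().[0] = dderiv idfun v (delta_mx 0 j) q.
    rewrite -[LHS]/((horner_eval 0 \o @deriv k \o line) q).
    rewrite (@dderiv_unique k k idfun n v) /=.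
    - congr (dderiv _ _ _ q); apply/rowP => i; rewrite !mxE /= /horner_eval lineX.
      by rewrite !derivE !hornerE eq_sym.
    - move=> a b /=; rewrite /horner_eval rmorphM derivM !hornerE !line_eval.
      by rewrite scale0r addr0.
    by move=> a; rewrite /= /horner_eval lineC derivC horner0.
  have := line_deriv p; rewrite line0 deriv0 horner0 /dderiv (bigD1 j) //= mxE !eqxx mul1r.
  rewrite big1 => [|i ij]; last by rewrite mxE eqxx (negbTE ij) mul0r.
  by rewrite addr0 => /esym.
have pC := mderiv_eq0_const char0 dp0.
by have := p0 0; rewrite pC mevalC => ->; rewrite mpolyC0.
Qed.

Definition vars (k : fieldType) n : 'rV[{mpoly k[n]}]_n := \row_i 'X_i.

Lemma meval_vars (k : fieldType) n (v : 'rV[k]_n) : map_mx (meval (v 0)) (vars k n) = v.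
Proof. by apply/rowP => i; rewrite !mxE mevalXU. Qed.

Lemma evalK_vars (k K : fieldType) (c : {rmorphism k -> K}) n (y : 'rV[K]_n) :
  map_mx (evalK c y) (vars k n) = y.
Proof. by apply/rowP => i; rewrite !mxE evalKX. Qed.

Lemma dderiv_vars (k K : fieldType) (c : {rmorphism k -> K}) n (y v : 'rV[K]_n) :
  map_mx (dderiv c y v) (vars k n) = v.
Proof. by apply/rowP => i; rewrite !mxE dderivX. Qed.

Definition prod_family (k : fieldType) T1 T2 N1 N2 (x1 : T1 -> 'rV[k]_N1) (x2 : T2 -> 'rV[k]_N2)
  (t : T1 * T2) : 'rV[k]_(N1 + N2) := row_mx (x1 t.1) (x2 t.2).

Section Product.
Variables (k : fieldType) (T1 T2 : Type) (N1 N2 : nat).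
Variables (x1 : T1 -> 'rV[k]_N1) (x2 : T2 -> 'rV[k]_N2).
Let x := prod_family x1 x2.

(** Restriction of polynomials on a product to a slice with fixed second factor. *)
Definition freeze_r n1 n2 (u : 'rV[k]_n2) : 'rV[{mpoly k[n1]}]_(n1 + n2) :=
  row_mx (vars k n1) (map_mx (@mpolyC n1 k) u).

Definition freeze_l n1 n2 (u : 'rV[k]_n1) : 'rV[{mpoly k[n2]}]_(n1 + n2) :=
  row_mx (map_mx (@mpolyC n2 k) u) (vars k n2).

Lemma freeze_rE n1 n2 (w : 'rV[k]_n1) (u : 'rV[k]_n2) p :
  (pull (freeze_r n1 u) p).@[w 0] = p.@[row_mx w u 0].
Proof.
rewrite pull_meval map_row_mx meval_vars -map_mx_comp map_mx_id // => a.
exact: mevalC.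
Qed.

Lemma freeze_lE n1 n2 (w : 'rV[k]_n1) (u : 'rV[k]_n2) p :
  (pull (freeze_l n2 w) p).@[u 0] = p.@[row_mx w u 0].
Proof.
rewrite pull_meval map_row_mx meval_vars -map_mx_comp map_mx_id // => a.
exact: mevalC.
Qed.

(** If neither p nor q vanishes on the product, pick a point where p does not
    and one where q does not; by irreducibility of the slices of the first
    factor the product of p and q, restricted to the first coordinates of these
    two points, vanishes on the second factor. *)
Lemma prod_irreducible :
  irreducible_family x1 -> irreducible_family x2 -> irreducible_family x.
Proof.
case=> [[a0] prime1] [[b0] prime2]; split; first by split; exact: (a0, b0).
move=> p q pq0.
have NN (P : Prop) : ~ ~ P -> P by case: (classic P).
apply: (NN) => /Decidable.not_or [].
have neg r : ~ vanishes x r -> exists t, r.@[x t 0] != 0.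
  move=> h; apply: NN => none; apply: h => t; apply/eqP/negPn/negP => rt.
  by apply: none; exists t.
move=> /neg [[a1 b1] pN0] /neg [[a2 b2] qN0].
have : vanishes x2 (pull (freeze_l N2 (x1 a1)) p * pull (freeze_l N2 (x1 a2)) q).
  move=> b; rewrite mevalM !freeze_lE.
  have : vanishes x1 (pull (freeze_r N1 (x2 b)) p * pull (freeze_r N1 (x2 b)) q).
    by move=> a; rewrite -rmorphM freeze_rE; apply: (pq0 (a, b)).
  by case/prime1 => [/(_ a1)|/(_ a2)]; rewrite freeze_rE => ->; rewrite ?mul0r ?mulr0.
case/prime2 => [/(_ b1)|/(_ b2)]; rewrite freeze_lE => /eqP.
  by rewrite (negbTE pN0).
by rewrite (negbTE qN0).
Qed.

Definition lvars : 'rV[{mpoly k[N1 + N2]}]_N1 := lsubmx (vars k (N1 + N2)).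
Definition rvars : 'rV[{mpoly k[N1 + N2]}]_N2 := rsubmx (vars k (N1 + N2)).

(** Freezing one factor at a time, a relation becomes a relation between the
    functions of a single factor, so it vanishes on the whole affine space. *)
Lemma prod_alg_indep n1 n2 (f1 : 'rV_n1) (f2 : 'rV_n2) :
    [pchar k] =i pred0 -> alg_indep x1 f1 -> alg_indep x2 f2 ->
  alg_indep x (row_mx (map_mx (pull lvars) f1) (map_mx (pull rvars) f2)).
Proof.
move=> char0 ind1 ind2 P P0.
have ev t1 t2 : P.@[row_mx (image_family f1 x1 t1) (image_family f2 x2 t2) 0] = 0.
  have := P0 (t1, t2); rewrite pull_meval map_row_mx -!map_mx_comp.
  have E1 : meval (x (t1, t2) 0) \o pull lvars =1 meval (x1 t1 0).
    by move=> q; rewrite /= pull_meval map_lsubmx meval_vars row_mxKl.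
  have E2 : meval (x (t1, t2) 0) \o pull rvars =1 meval (x2 t2 0).
    by move=> q; rewrite /= pull_meval map_rsubmx meval_vars row_mxKr.
  by rewrite (eq_map_mx _ E1) (eq_map_mx _ E2).
have ev1 w1 t2 : P.@[row_mx w1 (image_family f2 x2 t2) 0] = 0.
  rewrite -freeze_rE (ind1 (pull (freeze_r n1 (image_family f2 x2 t2)) P)) ?meval0 //.
  by apply/vanishes_image => t1; rewrite freeze_rE.
apply: mpoly_vanishes_everywhere => // w; rewrite -[w]hsubmxK.
rewrite -freeze_lE (ind2 (pull (freeze_l n2 (lsubmx w)) P)) ?meval0 //.
by apply/vanishes_image => t2; rewrite freeze_lE.
Qed.

Section Generic.
Variables (K : fieldType) (c : {rmorphism k -> K}) (y : 'rV[K]_(N1 + N2)).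
Hypothesis ygen : generic_point c x y.

Lemma prod_generic_l : inhabited T2 -> generic_point c x1 (lsubmx y).
Proof.
case=> t2 p.
have := ygen (pull lvars p); rewrite evalK_pull map_lsubmx !evalK_vars => ->.
split=> h t.
  by have := h (t, t2); rewrite pull_meval map_lsubmx meval_vars row_mxKl.
by rewrite pull_meval map_lsubmx meval_vars row_mxKl.
Qed.

Lemma prod_generic_r : inhabited T1 -> generic_point c x2 (rsubmx y).
Proof.
case=> t1 p.
have := ygen (pull rvars p); rewrite evalK_pull map_rsubmx !evalK_vars => ->.
split=> h t.
  by have := h (t1, t); rewrite pull_meval map_rsubmx meval_vars row_mxKr.
by rewrite pull_meval map_rsubmx meval_vars row_mxKr.
Qed.

Lemma prod_tangent_l v : tangent c x y v -> tangent c x1 (lsubmx y) (lsubmx v).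
Proof.
move=> vtan p p0; have /vtan : vanishes x (pull lvars p).
  by move=> t; rewrite pull_meval map_lsubmx meval_vars row_mxKl.
by rewrite chain_rule mul_jacobian !map_lsubmx evalK_vars dderiv_vars.
Qed.

Lemma prod_tangent_r v : tangent c x y v -> tangent c x2 (rsubmx y) (rsubmx v).
Proof.
move=> vtan p p0; have /vtan : vanishes x (pull rvars p).
  by move=> t; rewrite pull_meval map_rsubmx meval_vars row_mxKr.
by rewrite chain_rule mul_jacobian !map_rsubmx evalK_vars dderiv_vars.
Qed.

End Generic.
End Product.

(** The dimension of the closure of the subset parametrized by x. *)
Definition family_dim (k : fieldType) T N (x : T -> 'rV[k]_N) (n : nat) : Prop :=
  (exists f : 'rV_n, alg_indep x f) /\
  forall m (f : 'rV_m), alg_indep x f -> (m <= n)%N.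

Section Dim.
Variables (k K : fieldType) (c : {rmorphism k -> K}).
Hypothesis char0 : [pchar k] =i pred0.

Lemma image_family_dim T N (x : T -> 'rV[k]_N) (y : 'rV[K]_N) M
    (phi : 'rV[{mpoly k[N]}]_M) m (V : 'M[K]_(m, N)) :
    inhabited T -> generic_point c x y -> tangent_space c x y V ->
  family_dim (image_family phi x) (\rank (V *m jacobian c phi y)).
Proof.
move=> Tne ygen tanV; split; last by move=> n f; apply: (image_dim_le char0 ygen tanV).
have [n [g [-> gind]]] := image_dim_ge char0 ygen phi Tne tanV.
by exists g.
Qed.

Lemma family_dim_unique T N (x : T -> 'rV[k]_N) n1 n2 :
  family_dim x n1 -> family_dim x n2 -> n1 = n2.
Proof.
move=> [[f1 i1] max1] [[f2 i2] max2]; apply/eqP.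
by rewrite eqn_leq (max2 _ _ i1) (max1 _ _ i2).
Qed.

Lemma alg_indep_ext T N (x x' : T -> 'rV[k]_N) n (f : 'rV_n) :
  x =1 x' -> alg_indep x f -> alg_indep x' f.
Proof. by move=> e i P P0; apply: i => t; rewrite e. Qed.

Lemma tangent_space_dim T N (x : T -> 'rV[k]_N) (y : 'rV[K]_N) m (V : 'M[K]_(m, N)) :
    inhabited T -> generic_point c x y -> tangent_space c x y V ->
  family_dim x (\rank V).
Proof.
move=> Tne ygen tanV; have := image_family_dim (vars k N) Tne ygen tanV.
have -> : V *m jacobian c (vars k N) y = V.
  by apply/row_matrixP => i; rewrite row_mul mul_jacobian dderiv_vars.
have e : image_family (vars k N) x =1 x by move=> t; rewrite /image_family meval_vars.
have e' : x =1 image_family (vars k N) x by move=> t; rewrite e.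
case=> [[f find] fmax]; split.
  by exists f; apply: alg_indep_ext find.
by move=> n g gind; apply: (fmax n g); apply: alg_indep_ext gind.
Qed.

Lemma full_irreducible N : irreducible_family (@id 'rV[k]_N).
Proof.
split; first by split; exact: 0.
move=> p q /(mpoly_vanishes_everywhere char0) /eqP; rewrite mulf_eq0.
by case/orP=> /eqP ->; [left | right] => t; rewrite meval0.
Qed.

(** The tangent space of a product lies in the product of the tangent spaces,
    and the functions of [prod_alg_indep] leave no room for it to be smaller.
    The base field of the tangent spaces of the factors is the function field
    of the product, of which the factors also have generic points. *)
Lemma prod_tangent_dim T1 T2 N1 N2 (x1 : T1 -> 'rV[k]_N1) (x2 : T2 -> 'rV[k]_N2) n1 n2
    (y : 'rV[K]_(N1 + N2)) m (V : 'M[K]_(m, N1 + N2)) :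
    inhabited T1 -> inhabited T2 -> generic_point c (prod_family x1 x2) y ->
    tangent_space c (prod_family x1 x2) y V ->
    family_dim x1 n1 -> family_dim x2 n2 ->
  \rank V = (n1 + n2)%N.
Proof.
move=> ne1 ne2 ygen tanV dim1 dim2; apply/eqP; rewrite eqn_leq; apply/andP; split.
  have [V1 tanV1] := tangent_space_exists c x1 (lsubmx y).
  have [V2 tanV2] := tangent_space_exists c x2 (rsubmx y).
  have gen1 := prod_generic_l ygen ne2; have gen2 := prod_generic_r ygen ne1.
  rewrite (family_dim_unique dim1 (tangent_space_dim ne1 gen1 tanV1)).
  rewrite (family_dim_unique dim2 (tangent_space_dim ne2 gen2 tanV2)).
  rewrite -rank_diag_block_mx; apply: mxrankS.
  apply/row_subP => i; set v := row i V.
  have vtan : tangent c (prod_family x1 x2) y v by apply/tanV; apply: row_sub.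
  have /tanV1/submxP [a ea] := prod_tangent_l vtan.
  have /tanV2/submxP [b eb] := prod_tangent_r vtan.
  rewrite -[v]hsubmxK ea eb; apply/submxP; exists (row_mx a b).
  by rewrite mul_row_block !mulmx0 addr0 add0r.
have ne12 : inhabited (T1 * T2) by case: ne1 ne2 => a [b]; split; exact: (a, b).
have [_ maxV] := tangent_space_dim ne12 ygen tanV.
case: dim1 dim2 => [[f1 i1] _] [[f2 i2] _].
exact: (maxV _ _ (prod_alg_indep char0 i1 i2)).
Qed.

End Dim.

Lemma full_family_dim (k : fieldType) N :
  [pchar k] =i pred0 -> family_dim (@id 'rV[k]_N) N.
Proof.
move=> char0; split.
  exists (vars k N) => P P0; apply: mpoly_vanishes_everywhere => // v.
  by have := P0 v; rewrite pull_meval meval_vars.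
move=> n f find; have irr := full_irreducible char0 N; have [Ne _] := irr.
have [K [c [y ygen]]] := generic_point_exists irr.
have [V tanV] := tangent_space_exists c id y.
have [_ maxV] := tangent_space_dim char0 Ne ygen tanV.
by apply: leq_trans (maxV _ _ find) _; apply: rank_leq_col.
Qed.

(** * Block triangular representations and their deformations *)

Section Families.
Variables (T : finType) (m n : T -> nat).
Local Notation coord := (mxcoord m n).

(** Coordinates of [mxfam] with entries in an arbitrary ring: generic matrices
    over a polynomial ring and their specializations are treated alike. *)
Definition block (R : Type) (r : 'rV[R]_#|coord|) (t : T) : 'M[R]_(m t, n t) :=
  \matrix_(i, j) r 0 (enum_rank (Tagged (fun t => ('I_(m t) * 'I_(n t))%type) (i, j))).

Definition unblock (R : Type) (F : forall t, 'M[R]_(m t, n t)) : 'rV[R]_#|coord| :=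
  \row_l F (tag (enum_val l)) (tagged (enum_val l)).1 (tagged (enum_val l)).2.

Lemma unblockK (R : Type) (F : forall t, 'M[R]_(m t, n t)) t : block (unblock F) t = F t.
Proof. by apply/matrixP => i j; rewrite !mxE enum_rankK. Qed.

Lemma block_inj (R : Type) (r s : 'rV[R]_#|coord|) : (forall t, block r t = block s t) -> r = s.
Proof.
move=> e; apply/rowP => l; rewrite -(enum_valK l).
case: (enum_val l) => t [i j]; have := congr1 (fun M : 'M_(_, _) => M i j) (e t).
by rewrite !mxE.
Qed.

Lemma map_block (R R' : Type) (f : R -> R') (r : 'rV[R]_#|coord|) t :
  block (map_mx f r) t = map_mx f (block r t).
Proof. by apply/matrixP => i j; rewrite !mxE. Qed.

Lemma map_unblock (R R' : Type) (f : R -> R') (F : forall t, 'M[R]_(m t, n t)) :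
  map_mx f (unblock F) = unblock (fun t => map_mx f (F t)).
Proof. by apply/rowP => l; rewrite !mxE. Qed.

Lemma block_linear (R : pzRingType) (a : R) (r s : 'rV[R]_#|coord|) t :
  block (a *: r + s) t = a *: block r t + block s t.
Proof. by apply/matrixP => i j; rewrite !mxE. Qed.

Lemma block0 (R : pzRingType) t : block (0 : 'rV[R]_#|coord|) t = 0.
Proof. by apply/matrixP => i j; rewrite !mxE. Qed.

Lemma blockN (R : pzRingType) (r : 'rV[R]_#|coord|) t : block (- r) t = - block r t.
Proof. by apply/matrixP => i j; rewrite !mxE. Qed.

Variable k : fieldType.

Definition coords (X : mxfam k m n) : 'rV[k]_#|coord| := \row_l X (enum_val l).

Definition point (r : 'rV[k]_#|coord|) : mxfam k m n := mkfam (block r).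

Lemma block_coords (X : mxfam k m n) t : block (coords X) t = mxof X t.
Proof. by apply/matrixP => i j; rewrite !mxE enum_rankK. Qed.

Lemma mxof_point r t : mxof (point r) t = block r t.
Proof. exact: mxof_mkfam. Qed.

Lemma coordsK : cancel coords point.
Proof.
move=> X; rewrite -[RHS]mkfam_mxof; apply/ffunP => -[t [i j]].
by rewrite !ffunE /= block_coords.
Qed.

Lemma pointK : cancel point coords.
Proof. by move=> r; apply: block_inj => t; rewrite block_coords mxof_point. Qed.

End Families.

Lemma rep_evalE (k : fieldType) (Q : quiver) (d : dimvec Q) (p : rep_mpoly k d) (X : rep k d) :
  rep_eval p X = p.@[coords X 0].
Proof. by apply: meval_eq => i; rewrite mxE. Qed.

Lemma map_derivation_mulmx (S : comNzRingType) (K : fieldType) (ev : {rmorphism S -> K})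
    (D : {additive S -> K}) m n p (A : 'M[S]_(m, n)) (B : 'M_(n, p)) :
  derivation ev D ->
  map_mx D (A *m B) = map_mx D A *m map_mx ev B + map_mx ev A *m map_mx D B.
Proof.
move=> dD; apply/matrixP => i j; rewrite !mxE raddf_sum -big_split /=.
by apply: eq_bigr => l _; rewrite !mxE dD.
Qed.

Lemma derivation1 (S : comNzRingType) (K : fieldType) (ev : {rmorphism S -> K})
    (D : {additive S -> K}) : derivation ev D -> D 1 = 0.
Proof.
move=> dD; have /eqP := dD 1 1; rewrite mulr1 rmorph1 mul1r mulr1.
by rewrite -subr_eq0 opprD addNKr oppr_eq0 => /eqP.
Qed.

Section Assemble.
Variables (Q : quiver) (d e : dimvec Q).

Local Notation NM := #|mxcoord (fun a : arrow Q => d (src a)) (fun a => d (tgt a))|.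
Local Notation NN := #|mxcoord (fun a : arrow Q => e (src a)) (fun a => e (tgt a))|.
Local Notation Nxi := #|mxcoord (fun a : arrow Q => d (src a)) (fun a => e (tgt a))|.
Local Notation Nnu := #|mxcoord e d|.
Local Notation c := (dimvec_add d e).
Local Notation NX := #|mxcoord (fun a : arrow Q => c (src a)) (fun a => c (tgt a))|.
Local Notation Npar := (NM + (NN + (Nxi + Nnu)))%N.

Definition partM R (w : 'rV[R]_Npar) : 'rV[R]_NM := lsubmx w.
Definition partN R (w : 'rV[R]_Npar) : 'rV[R]_NN := lsubmx (rsubmx w).
Definition partxi R (w : 'rV[R]_Npar) : 'rV[R]_Nxi := lsubmx (rsubmx (rsubmx w)).
Definition partnu R m (w : 'M[R]_(m, Npar)) : 'M[R]_(m, Nnu) := rsubmx (rsubmx (rsubmx w)).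

(** Matrices act on row vectors, so the last [e i] coordinates span the
    subrepresentation N and the quotient by it is M. *)
Definition triangular (R : pzRingType) (w : 'rV[R]_Npar) (a : arrow Q) :
    'M[R]_(d (src a) + e (src a), d (tgt a) + e (tgt a)) :=
  block_mx (block (partM w) a) (block (partxi w) a) 0 (block (partN w) a).

Definition unipotent (R : pzRingType) (nu : 'rV[R]_Nnu) (i : vertex Q) : 'M[R]_(d i + e i) :=
  block_mx 1%:M 0 (block nu i) 1%:M.

Lemma unipotentM (R : pzRingType) (nu nu' : 'rV[R]_Nnu) i :
  unipotent nu i *m unipotent nu' i = unipotent (nu + nu') i.
Proof.
rewrite /unipotent mulmx_block !mul1mx !mulmx1 !mul0mx !mulmx0 !addr0 add0r.
by rewrite -[nu]scale1r block_linear !scale1r.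
Qed.

Lemma unipotent0 (R : pzRingType) i : unipotent (0 : 'rV[R]_Nnu) i = 1%:M.
Proof. by rewrite /unipotent block0 -scalar_mx_block. Qed.

Definition assemble (R : pzRingType) (w : 'rV[R]_Npar) : 'rV[R]_NX :=
  unblock (fun a => unipotent (- partnu w) (src a) *m triangular w a
                      *m unipotent (partnu w) (tgt a)).

Lemma map_unipotent (R R' : pzRingType) (f : {rmorphism R -> R'}) nu i :
  map_mx f (unipotent nu i) = unipotent (map_mx f nu) i.
Proof.
by rewrite /unipotent map_block_mx !map_mx1 map_mx0 map_block.
Qed.

Lemma map_triangular (R R' : pzRingType) (f : {rmorphism R -> R'}) w a :
  map_mx f (triangular w a) = triangular (map_mx f w) a.
Proof.
rewrite /triangular map_block_mx map_mx0 -!map_block.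
by rewrite /partM /partxi /partN -!(map_lsubmx, map_rsubmx).
Qed.

Lemma map_assemble (R R' : pzRingType) (f : {rmorphism R -> R'}) w :
  map_mx f (assemble w) = assemble (map_mx f w).
Proof.
apply: block_inj => a; rewrite map_unblock !unblockK !map_mxM !map_unipotent map_triangular.
by rewrite /partnu -!map_rsubmx -map_mxN.
Qed.

(** Conjugating back by the unipotent matrices turns the derivative of
    (1 - nu) Z (1 + nu) into dZ - dnu Z + Z dnu, and its four blocks are the
    four equations. *)
Lemma assemble_deriv_eq0 (S : comNzRingType) (K : fieldType) (ev : {rmorphism S -> K})
    (D : {additive S -> K}) (w : 'rV[S]_Npar) (a : arrow Q) :
    derivation ev D -> map_mx D (assemble w) = 0 ->
  let y := map_mx ev w in let v := map_mx D w in
  [/\ block (partN y) a *m block (partnu v) (tgt a) =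
        block (partnu v) (src a) *m block (partM y) a,
      block (partM v) a = - (block (partxi y) a *m block (partnu v) (tgt a)),
      block (partxi v) a = 0
    & block (partN v) a = block (partnu v) (src a) *m block (partxi y) a].
Proof.
move=> dD /(congr1 (fun r => block r a)); rewrite map_block unblockK block0 /=.
set y := map_mx ev w; set v := map_mx D w.
have Du nu i : map_mx D (unipotent nu i) = block_mx 0 0 (block (map_mx D nu) i) 0.
  rewrite /unipotent map_block_mx raddf0 map_block /=.
  suff D1 q : map_mx D (1%:M : 'M_q) = 0 by rewrite !D1.
  by apply/matrixP => l j; rewrite !mxE; case: eqP => _; rewrite ?raddf0 // (derivation1 dD).
have DZ : map_mx D (triangular w a) =
   block_mx (block (partM v) a) (block (partxi v) a) 0 (block (partN v) a).
  rewrite /triangular map_block_mx raddf0 -!map_block.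
  by rewrite /partM /partxi /partN -!(map_lsubmx, map_rsubmx).
have evnu : map_mx ev (partnu w) = partnu y by rewrite /partnu !map_rsubmx.
have Dnu : map_mx D (partnu w) = partnu v by rewrite /partnu !map_rsubmx.
rewrite !(map_derivation_mulmx _ _ dD) map_mxM !map_unipotent map_triangular !Du DZ.
rewrite !raddfN /= evnu Dnu -/y; set nu := partnu y; set dnu := partnu v.
set Z := triangular y a; set DZ' := block_mx (block (partM v) a) _ _ _.
pose E i : 'M_(d i + e i) := block_mx 0 0 (block dnu i) 0.
have -> : block_mx 0 0 (block (- dnu) (src a)) 0 = - E (src a).
  by rewrite /E opp_block_mx !oppr0 blockN.
have UU i : unipotent nu i *m unipotent (- nu) i = 1%:M.
  by rewrite unipotentM addrN unipotent0.
have UE i : unipotent nu i *m E i = E i.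
  by rewrite /E mulmx_block !mul1mx !mulmx0 !mul0mx ?addr0 ?add0r ?addr0.
have EU i : E i *m unipotent (- nu) i = E i.
  by rewrite /E mulmx_block !mulmx1 !mulmx0 !mul0mx ?addr0 ?add0r ?addr0.
move/(congr1 (fun X => unipotent nu (src a) *m X *m unipotent (- nu) (tgt a))).
rewrite mulmx0 mul0mx !(mulmxDr, mulmxDl) !mulmxA mulmxN !mulNmx UE UU !mul1mx.
rewrite -!mulmxA UU !mulmx1 EU /E /Z /DZ' /triangular !mulmx_block !mul0mx !mulmx0.
rewrite !addr0 !add0r opp_block_mx !add_block_mx.
rewrite -[X in _ = X -> _](@block_mx0 _ (d (src a)) (e (src a)) (d (tgt a)) (e (tgt a))).
case/eq_block_mx; rewrite ?oppr0 ?addr0 ?add0r => eM exi enu eN.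
split=> //.
- by apply/eqP; rewrite -subr_eq0 addrC enu.
- by apply/eqP; rewrite -addr_eq0 eM.
by apply/eqP; rewrite -subr_eq0 addrC eN.
Qed.

Definition hom_eq (R : pzRingType) (N : 'rV[R]_NN) (M : 'rV[R]_NM) (h : 'rV[R]_Nnu) :
    'rV[R]_#|mxcoord (fun a : arrow Q => e (src a)) (fun a => d (tgt a))| :=
  unblock (fun a => block N a *m block h (tgt a) - block h (src a) *m block M a).

(** The linear system whose solutions are the homomorphisms from N to M. *)
Definition hom_mx (R : pzRingType) (N : 'rV[R]_NN) (M : 'rV[R]_NM) :=
  lin1_mx (hom_eq N M).

Lemma hom_eq_linear (R : comPzRingType) (N : 'rV[R]_NN) (M : 'rV[R]_NM) :
  linear (hom_eq N M).
Proof.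
move=> a r s; apply: block_inj => t; rewrite block_linear !unblockK !block_linear.
by rewrite mulmxDl mulmxDr -scalemxAl -scalemxAr scalerBr opprD addrACA.
Qed.

HB.instance Definition _ (R : comPzRingType) N M :=
  GRing.isLinear.Build R _ _ _ (@hom_eq R N M) (hom_eq_linear N M).

Lemma mul_hom_mx (R : comPzRingType) (N : 'rV[R]_NN) (M : 'rV[R]_NM) h :
  h *m hom_mx N M = hom_eq N M h.
Proof. exact: mul_rV_lin1. Qed.

Lemma map_hom_mx (R R' : pzRingType) (f : {rmorphism R -> R'}) (N : 'rV[R]_NN) (M : 'rV[R]_NM) :
  map_mx f (hom_mx N M) = hom_mx (map_mx f N) (map_mx f M).
Proof.
apply/matrixP => l l'; rewrite !mxE /hom_eq.
rewrite rmorphB /= !rmorph_sum; congr (_ - _); apply: eq_bigr => i _.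
  by rewrite rmorphM !mxE rmorph_nat.
by rewrite rmorphM !mxE rmorph_nat.
Qed.

End Assemble.

(** * Extensions and the block triangular chart *)

(** A nonzero minor at a point of the family is a polynomial that does not vanish
    on it, so it is nonzero at the generic point. *)
Lemma rank_generic_point_ge (k K : fieldType) (c : {rmorphism k -> K}) T N (x : T -> 'rV[k]_N)
    (y : 'rV[K]_N) m n (H : 'M[{mpoly k[N]}]_(m, n)) t :
    generic_point c x y ->
  (\rank (map_mx (meval (x t 0%R)) H) <= \rank (map_mx (evalK c y) H))%N.
Proof.
move=> ygen; set H0 := map_mx _ H.
have /row_fullP [L LH] := col_base_full H0.
have /row_freeP [R RH] := row_base_free H0.
have LHR : L *m H0 *m R = 1%:M.
  have : L *m (col_base H0 *m row_base H0) *m R = 1%:M by rewrite (mulmxA L) LH mul1mx RH.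
  by rewrite mulmx_base.
pose C a b (A : 'M[k]_(a, b)) := map_mx (@mpolyC N k) A.
(* Bordering by L and R turns a maximal nonzero minor into a determinant that
   is 1 at the given point. *)
pose D := \det (C _ _ L *m H *m C _ _ R).
have D1 : D.@[x t 0] = 1.
  rewrite /D -det_map_mx !map_mxM -!map_mx_comp !(map_mx_id (fun a => mevalC _ a)) -/H0.
  by rewrite LHR det1.
have DN0 : evalK c y D != 0.
  apply: contra_eq_neq D1 => /eqP; rewrite eq_sym => /eqP/esym/ygen ->.
  by rewrite eq_sym oner_neq0.
move: DN0; rewrite /D -det_map_mx -unitfE -unitmxE !map_mxM => /mxrank_unit {1}<-.
exact: leq_trans (mxrankM_maxl _ _) (mxrankM_maxr _ _).
Qed.

Lemma dim_Hom_ge (k : fieldType) (Q : quiver) (d e : dimvec Q) (N : rep k e) (M : rep k d) :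
  (\rank (kermx (hom_mx (coords N) (coords M))) <= \dim (Defs.Hom N M))%N.
Proof.
set H := kermx _; pose B := row_base H.
have BH (a : 'rV_(\rank H)) : a *m B *m hom_mx (coords N) (coords M) = 0.
  by apply/sub_kermxP/(submx_trans (submxMl a B)); rewrite /B eq_row_base.
pose g (a : 'rV[k]_(\rank H)) : mxfam k e d := point (a *m B).
have glin : linear g.
  move=> s a b; rewrite /g mulmxDl -scalemxAl.
  rewrite -[RHS]mkfam_mxof /point; apply/ffunP => -[i [p q]].
  by rewrite !ffunE /= mxofP block_linear !mxof_point.
pose g' : {linear 'rV[k]_(\rank H) -> mxfam k e d} :=
  HB.pack g (GRing.isLinear.Build k _ _ _ g glin).
have ginj : lker (linfun g') == 0%VS.
  apply/lker0P => a b; rewrite !lfunE /= => /(can_inj (@pointK _ _ _ _)).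
  exact: (row_free_inj (row_base_free H)).
have sub : (limg (linfun g') <= Defs.Hom N M)%VS.
  apply/subvP => f /memv_imgP [a _ ->]; rewrite lfunE /=; apply/Defs.HomP => t.
  have := BH a; rewrite mul_hom_mx => /(congr1 (fun r => block r t)).
  rewrite unblockK block0 !block_coords => /eqP; rewrite subr_eq0 => /eqP e0.
  by rewrite !mxof_point.
apply: leq_trans (dimvS sub); rewrite limg_dim_eq ?dimvf ?(eqP ginj) ?capv0 //.
by rewrite /dim /= mul1n.
Qed.

(** The rows of (f1 f2) are independent, so some combination f1 g1 + f2 g2 is the
    identity; then f1 g1 + f2 (g2 + t) = 1 + t f2 is invertible for almost
    all t, and so is g2 + t; take mu = g1 (g2 + t)^-1. *)
Lemma complement_exists (k : fieldType) m n (f1 : 'M[k]_(n, m)) (f2 : 'M[k]_n) :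
    [pchar k] =i pred0 -> row_free (row_mx f1 f2) ->
  exists mu : 'M_(m, n), f2 + f1 *m mu \in unitmx.
Proof.
move=> char0 /row_freeP [G]; rewrite -[G]vsubmxK mul_row_col.
set g1 := usubmx G; set g2 := dsubmx G => fg.
pose p1 := \det (1%:M + 'X *: map_mx polyC f2); pose p2 := char_poly (- g2).
have ev1 t : p1.[t] = \det (1%:M + t *: f2).
  rewrite -[LHS]/(horner_eval t p1) -det_map_mx map_mxD map_mx1 map_mxZ.
  rewrite /= /horner_eval hornerX -map_mx_comp map_mx_id // => a /=.
  by rewrite /horner_eval hornerC.
have ev2 t : p2.[t] = \det (t%:M + g2).
  rewrite -[LHS]/(horner_eval t p2) -det_map_mx; congr (\det _).
  apply/matrixP => i j; rewrite !mxE /= /horner_eval hornerD hornerN hornerC opprK.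
  by rewrite hornerMn hornerX.
have pN0 : p1 * p2 != 0.
  apply: mulf_neq0; last by rewrite monic_neq0 ?char_poly_monic.
  apply/eqP => p10; have := ev1 0; rewrite p10 horner0 scale0r addr0 det1 => /eqP.
  by rewrite eq_sym oner_eq0.
have [t] : exists t, (p1 * p2).[t] != 0.
  case: (classic (exists t, (p1 * p2).[t] != 0)) => // none.
  case/eqP: pN0; apply: poly_vanishes_everywhere => // t.
  by apply/eqP/negPn/negP => h; apply: none; exists t.
rewrite hornerM mulf_eq0 negb_or ev1 ev2 -!unitfE -!unitmxE => /andP [u1 u2].
exists (g1 *m invmx (t%:M + g2)); set S := f2 + _.
have : S *m (t%:M + g2) = 1%:M + t *: f2.
  rewrite mulmxDl !mulmxA mulmxKV // mulmxDr mul_mx_scalar -addrA.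
  by rewrite [f2 *m _ + _]addrC fg addrC.
by move=> eS; move: u1; rewrite -eS unitmx_mul => /andP [].
Qed.

Section Charts.
Variables (k : fieldType) (Q : quiver) (d e : dimvec Q).
Variables (A : rep k d -> Prop) (B : rep k e -> Prop).
Hypotheses (char0 : [pchar k] =i pred0) (stA : stable A) (stB : stable B).

Local Notation c := (dimvec_add d e).

Lemma unipotent_row (nu : 'rV[k]_#|mxcoord e d|) i :
  row_mx 0 1%:M *m unipotent nu i = row_mx (block nu i) 1%:M.
Proof. by rewrite mul_row_block !mul0mx !mul1mx !add0r. Qed.

Lemma unipotent_col (nu : 'rV[k]_#|mxcoord e d|) i :
  unipotent nu i *m col_mx 1%:M 0 = col_mx 1%:M (block nu i).
Proof. by rewrite mul_block_col !mulmx0 !mulmx1 !addr0. Qed.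

Lemma unipotent_rowK (nu : 'rV[k]_#|mxcoord e d|) i :
  row_mx (block nu i) 1%:M *m unipotent (- nu) i = row_mx 0 1%:M.
Proof. by rewrite mul_row_block mulmx0 !mulmx1 mul1mx blockN addrN add0r. Qed.

Lemma unipotent_colK (nu : 'rV[k]_#|mxcoord e d|) i :
  unipotent nu i *m col_mx 1%:M (- block nu i) = col_mx 1%:M 0.
Proof. by rewrite mul_block_col mul0mx !mulmx1 mul1mx addr0 addrN. Qed.

Lemma assemble_extension (w : 'rV[k]_(_)) :
  A (point (partM w)) -> B (point (partN w)) ->
  extension_set A B (point (assemble w)).
Proof.
move=> AM BN; pose nu i := block (partnu w) i.
exists (point (partM w)), (point (partN w)),
  (mkfam (fun i => row_mx (nu i) 1%:M)), (mkfam (fun i => col_mx 1%:M (- nu i))).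
split=> //.
- apply/Defs.HomP => a; rewrite !mxof_mkfam ?mxof_point unblockK.
  rewrite !mulmxA unipotent_rowK mul_row_block !mul0mx !mul1mx !add0r.
  by rewrite mul_row_block mul_mx_row !mul0mx !mulmx1 !add0r.
- apply/Defs.HomP => a; rewrite !mxof_mkfam ?mxof_point unblockK.
  rewrite -!mulmxA unipotent_colK mul_block_col !mulmx0 !mulmx1 !addr0.
  by rewrite mul_block_col mul_col_mx !mulmx0 !mul1mx !addr0 blockN.
move=> i; rewrite !mxof_mkfam; split.
- by apply/row_freeP; exists (col_mx 0 1%:M); rewrite mul_row_col mulmx0 mulmx1 add0r.
- apply/andP; split.
    by apply/sub_kermxP; rewrite mul_row_col mulmx1 mul1mx addrN.
  set g := col_mx _ _; have : kermx g *m g = 0 by apply: mulmx_ker.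
  rewrite -[X in X *m _ = _ -> _]hsubmxK mul_row_col mulmx1 mulmxN => /eqP.
  rewrite subr_eq0 => /eqP e1; apply/submxP; exists (rsubmx (kermx g)).
  by rewrite -[LHS]hsubmxK e1 mul_mx_row mulmx1.
by apply/row_fullP; exists (row_mx 1%:M 0); rewrite mul_row_col mul0mx mulmx1 addr0.
Qed.

(** If the subspaces f are complementary to the first coordinate subspaces, their
    bases can be normalized to (nu 1), and conjugation by 1 + nu makes X block
    triangular.  Normalizing changes N and M only by base changes. *)
Lemma extension_assemble (X : rep k c) (M : rep k d) (N : rep k e)
    (f : forall i, 'M[k]_(e i, d i + e i)) (g : forall i, 'M[k]_(d i + e i, d i)) :
    A M -> B N ->
    (forall a, mxof N a *m f (tgt a) = f (src a) *m mxof X a) ->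
    (forall a, mxof X a *m g (tgt a) = g (src a) *m mxof M a) ->
    (forall i, f i *m g i = 0) -> (forall i, row_full (g i)) ->
    (forall i, rsubmx (f i) \in unitmx) ->
  exists w, [/\ A (point (partM w)), B (point (partN w)) & X = point (assemble w)].
Proof.
move=> AM BN fN gM fg gfull f2.
pose nu : 'rV[k]_#|mxcoord e d| := unblock (fun i => invmx (rsubmx (f i)) *m lsubmx (f i)).
have fE i : f i = rsubmx (f i) *m row_mx (block nu i) 1%:M.
  by rewrite unblockK mul_mx_row mulmxA mulmxV // mul1mx mulmx1 hsubmxK.
have rE i : row_mx (block nu i) 1%:M = invmx (rsubmx (f i)) *m f i.
  by rewrite {2}fE mulmxA mulVmx // mul1mx.
have gE i : g i = col_mx 1%:M (- block nu i) *m usubmx (g i).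
  have : row_mx (block nu i) 1%:M *m g i = 0 by rewrite rE -mulmxA fg mulmx0.
  rewrite -{1}[g i]vsubmxK mul_row_col mul1mx addrC => /eqP; rewrite addr_eq0 => /eqP dg.
  by rewrite mul_col_mx mul1mx mulNmx -dg vsubmxK.
have g1 i : usubmx (g i) \in unitmx.
  rewrite -row_full_unit; apply/row_fullP.
  have /row_fullP [h hg] := gfull i; exists (h *m col_mx 1%:M (- block nu i)).
  by rewrite -mulmxA -gE.
pose Z a := unipotent nu (src a) *m mxof X a *m unipotent (- nu) (tgt a).
pose M' := rep_act (fun i => usubmx (g i)) M.
pose N' := rep_act (fun i => invmx (rsubmx (f i))) N.
have Zd a : row_mx 0 1%:M *m Z a = row_mx 0 (mxof N' a).
  rewrite /Z !mulmxA unipotent_row rE -(mulmxA _ (f _)) -fN (fE (tgt a)) !mulmxA.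
  rewrite -(mulmxA _ (row_mx (block nu _) _)) unipotent_rowK mul_mx_row mulmx0 mulmx1.
  by rewrite mxof_mkfam invmxK.
have Zl a : Z a *m col_mx 1%:M 0 = col_mx (mxof M' a) 0.
  have g_tgt : col_mx 1%:M (- block nu (tgt a)) = g (tgt a) *m invmx (usubmx (g (tgt a))).
    by rewrite {1}gE mulmxK.
  rewrite /Z -!mulmxA unipotent_col blockN g_tgt (mulmxA (mxof X a)) gM gE !mulmxA.
  rewrite unipotent_colK.
  by rewrite !mul_col_mx !mul0mx !mul1mx mxof_mkfam.
exists (row_mx (coords M') (row_mx (coords N') (row_mx (unblock (fun a => ursubmx (Z a))) nu))).
rewrite /partM /partN !row_mxKr !row_mxKl !coordsK; split.
- by apply: stA.
- by apply: stB => // i; rewrite unitmx_inv.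
rewrite -[X]coordsK; congr (point _); apply: block_inj => a.
rewrite unblockK block_coords /partnu !row_mxKr /triangular /partM /partN /partxi.
rewrite !row_mxKr !row_mxKl unblockK !block_coords.
suff <- : Z a = block_mx (mxof M' a) (ursubmx (Z a)) 0 (mxof N' a).
  rewrite /Z !mulmxA.
  have U'U i : unipotent (- nu) i *m unipotent nu i = 1%:M.
    by rewrite unipotentM addNr unipotent0.
  by rewrite U'U mul1mx -mulmxA U'U mulmx1.
have := Zl a; rewrite -{1}[Z a]submxK mul_block_col !mulmx0 !mulmx1 !addr0.
move=> /eq_col_mx [eul edl].
have := Zd a; rewrite -{1}[Z a]submxK mul_row_block !mul0mx !mul1mx !add0r.
move=> /eq_row_mx [_ edr].
by rewrite -{1}[Z a]submxK eul edl edr.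
Qed.

(** A unipotent change of coordinates with a parameter t moves the subspaces f to
    complementary position for almost all t, without denominators in t; a
    polynomial in t with infinitely many zeros vanishes at t = 0. *)
Lemma extension_dense (p : rep_mpoly k c) :
    (forall w, A (point (partM w)) -> B (point (partN w)) ->
       rep_eval p (point (assemble w)) = 0) ->
  forall X, extension_set A B X -> rep_eval p X = 0.
Proof.
move=> p0 X [M [N [f [g [AM BN /Defs.HomP fN /Defs.HomP gM ex]]]]].
pose f1 i : 'M_(e i, d i) := lsubmx (mxof f i : 'M_(e i, d i + e i)).
pose f2 i : 'M_(e i) := rsubmx (mxof f i : 'M_(e i, d i + e i)).
have [mu muP] : exists mu : forall i, 'M_(d i, e i), forall i, f2 i + f1 i *m mu i \in unitmx.
  have mu i : {m | f2 i + f1 i *m m \in unitmx}.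
    apply: constructive_indefinite_description; apply: complement_exists => //.
    by rewrite hsubmxK; case: (ex i).
  by exists (fun i => sval (mu i)) => i; apply: svalP (mu i).
pose shear (R : pzRingType) (s : R) (m : forall i, 'M[R]_(d i, e i)) i : 'M[R]_(d i + e i) :=
  block_mx 1%:M (s *: m i) 0 1%:M.
have shearN t i : shear k (- t) mu i *m shear k t mu i = 1%:M.
  rewrite /shear mulmx_block !mul1mx !mulmx1 !mul0mx !mulmx0 !addr0 add0r.
  by rewrite scaleNr addrN -scalar_mx_block.
pose move_mx t : 'rV[k]_(_) :=
  unblock (fun a => shear k (- t) mu (src a) *m mxof X a *m shear k t mu (tgt a)).
(* h is nonzero at t = 1, and where h is nonzero the moved representation lies
   in the chart of [extension_assemble]. *)
pose h := \prod_i \det (map_mx polyC (f2 i) + 'X *: map_mx polyC (f1 i *m mu i)).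
have hE t : h.[t] = \prod_i \det (f2 i + t *: (f1 i *m mu i)).
  rewrite -[LHS]/(horner_eval t h) rmorph_prod; apply: eq_bigr => i _.
  rewrite -det_map_mx map_mxD map_mxZ -!map_mx_comp /= /horner_eval hornerX.
  by rewrite !(map_mx_id (fun a => hornerC a t)).
pose pX a := map_mx polyC (mxof X a).
pose pmu i := map_mx polyC (mu i).
pose line : 'rV[{poly k}]_(_) :=
  unblock (fun a => shear _ (- 'X) pmu (src a) *m pX a *m shear _ 'X pmu (tgt a)).
pose q : {poly k} := mmap polyC (line 0) p.
have map_shear (t : k) (s : {poly k}) m i : map_mx (horner_eval t) (shear _ s m i) =
    shear _ s.[t] (fun i => map_mx (horner_eval t) (m i)) i.
  by rewrite /shear map_block_mx !map_mx1 map_mx0 map_mxZ.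
have evC (t : k) m n (G : 'M[k]_(m, n)) : map_mx (horner_eval t) (map_mx polyC G) = G.
  by rewrite -map_mx_comp map_mx_id // => a; apply: hornerC.
have lineE t : map_mx (horner_eval t) line = move_mx t.
  apply: block_inj => a; rewrite map_unblock !unblockK !map_mxM !map_shear evC.
  by rewrite /shear !evC hornerN hornerX.
have qE t : q.[t] = p.@[move_mx t 0].
  rewrite -lineE -[LHS]/((horner_eval t \o mmap polyC (line 0)) p).
  move: (p); apply: (@mpoly_rmorph_ext k k _) => [a | i] /=.
    by rewrite mmapC mevalC; apply: hornerC.
  by rewrite mmapX mmap1U mevalXU [RHS]mxE.
have hN0 : h != 0.
  apply/eqP => h0; have := hE 1; rewrite h0 horner0 => /esym/eqP; rewrite prodf_seq_eq0.
  case/hasP=> i _ /=; apply/negP; rewrite -unitfE -unitmxE scale1r; exact: muP.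
have q0 : q = 0.
  apply/eqP; have : q * h == 0.
    apply/eqP/poly_vanishes_everywhere => // t; rewrite hornerM.
    have [-> | htN0] := eqVneq h.[t] 0; first by rewrite mulr0.
    rewrite qE -[move_mx t]pointK -rep_evalE.
    have unit_t i : f2 i + t *: (f1 i *m mu i) \in unitmx.
      rewrite unitmxE unitfE; move: htN0; rewrite hE; apply: contraNneq => det0.
      by rewrite (bigD1 i) //= det0 mul0r.
    have shearK i : shear k t mu i *m shear k (- t) mu i = 1%:M.
      by rewrite -{1}[t]opprK shearN.
    have [] := @extension_assemble (point (move_mx t)) M N
      (fun i => mxof f i *m shear k t mu i) (fun i => shear k (- t) mu i *m mxof g i) AM BN.
    - move=> a; rewrite mulmxA fN mxof_point unblockK !mulmxA.
      by rewrite -(mulmxA (mxof f _) (shear k t mu _)) shearK mulmx1.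
    - move=> a; rewrite -mulmxA -gM mxof_point unblockK !mulmxA.
      by rewrite -(mulmxA _ (shear k t mu _)) shearK mulmx1.
    - move=> i; rewrite mulmxA -(mulmxA (mxof f i)) shearK mulmx1.
      by have [_ /andP [/sub_kermxP]] := ex i.
    - move=> i; have [_ _ gfull] := ex i.
      rewrite /row_full eqmxMfull // row_full_unit.
      by have := mulmx1_unit (shearN t i); case.
    - move=> i; rewrite -[mxof f i](@hsubmxK _ (e i) (d i) (e i)) mul_row_block row_mxKr.
      by rewrite mulmx1 addrC -scalemxAr; apply: unit_t.
    by move=> w [Aw Bw ->]; rewrite p0 ?mul0r.
  by rewrite mulf_eq0 (negbTE hN0) orbF.
have := qE 0; rewrite q0 horner0 rep_evalE => /esym.
suff -> : move_mx 0 = coords X by [].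
apply: block_inj => a; rewrite unblockK block_coords oppr0 /shear !scale0r -!scalar_mx_block.
by rewrite mul1mx mulmx1.
Qed.

End Charts.

(** * Dimensions of varieties of representations *)

Lemma maximum_eq (P : nat -> Prop) n :
  P n -> (forall m, P m -> (m <= n)%N) -> maximum P = n.
Proof.
move=> Pn maxn; rewrite /maximum; set m := epsilon _ _.
have [Pm maxm] : P m /\ forall l, P l -> (l <= m)%N.
  by apply: (@epsilon_spec _ _ (fun n => P n /\ forall m, P m -> (m <= n)%N)); exists n.
by apply/eqP; rewrite eqn_leq maxn // maxm.
Qed.

Lemma minimum_spec (P : nat -> Prop) : (exists n, P n) -> P (minimum P).
Proof.
move=> exP.
suff [] : P (minimum P) /\ forall m, P m -> (minimum P <= m)%N by [].
apply: (@epsilon_spec _ _ (fun n => P n /\ forall m, P m -> (n <= m)%N)).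
case: exP => n; have [m] := ubnP n; elim: m n => // m IH n lt Pn.
case: (classic (exists2 l, P l & (l < n)%N)) => [[l Pl ltl]|none].
  by apply: (IH l) => //; lia.
exists n; split=> // l Pl; rewrite leqNgt; apply/negP => ltl; apply: none; exists l => //.
Qed.

Lemma card_mxcoord (T : finType) (m n : T -> nat) :
  #|mxcoord m n| = (\sum_t m t * n t)%N.
Proof.
rewrite card_tagged sumnE big_map big_enum /=; apply: eq_bigr => t _.
by rewrite card_prod !card_ord.
Qed.

(** The closure of A and that of the family have the same ideal, which is all
    that algebraic independence sees. *)
Lemma variety_dim_family (k : fieldType) (Q : quiver) (d : dimvec Q) (A : rep k d -> Prop)
    T (x : T -> 'rV[k]_#|mxcoord (fun a : arrow Q => d (src a)) (fun a => d (tgt a))|) n :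
    (forall p, (forall X, A X -> rep_eval p X = 0) <-> vanishes x p) ->
    family_dim x n ->
  variety_dim A = n.
Proof.
move=> sameI [[f find] maxf].
have compE m (g : m.-tuple (rep_mpoly k d)) P : P \mPo g = pull (\row_i tnth g i) P.
  apply: (@mpoly_rmorph_ext k _ m (comp_mpoly g) (pull (\row_i tnth g i))) => [a | i] /=.
    by rewrite comp_mpolyC pullC.
  by rewrite comp_mpolyXU pullX mxE (tnth_nth 0).
apply: maximum_eq => [|m [g gind]].
  exists [tuple f 0 i | i < n] => P /sameI; rewrite compE => P0; apply: find.
  suff <- : \row_i tnth [tuple f 0 i | i < n] i = f by [].
  by apply/rowP => i; rewrite mxE tnth_mktuple.
by apply: (maxf _ (\row_i tnth g i)) => P P0; apply: gind; apply/sameI; rewrite compE.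
Qed.

Definition set_family (k : fieldType) (Q : quiver) (d : dimvec Q) (A : rep k d -> Prop)
  (t : {X | A X}) := coords (sval t).

Lemma set_family_vanishes (k : fieldType) (Q : quiver) (d : dimvec Q) (A : rep k d -> Prop) p :
  (forall X, A X -> rep_eval p X = 0) <-> vanishes (@set_family k Q d A) p.
Proof.
split=> [h [X AX] | h X AX]; first by rewrite /set_family /= -rep_evalE h.
by rewrite rep_evalE; apply: (h (exist _ X AX)).
Qed.

Lemma set_family_irreducible (k : fieldType) (Q : quiver) (d : dimvec Q) (A : rep k d -> Prop) :
  irreducible_set A -> irreducible_family (@set_family k Q d A).
Proof.
case=> [[X0 AX0] irrA]; split; first by split; exists X0.
move=> p q /set_family_vanishes pq0.
have closed (r : rep_mpoly k d) : zariski_closed (fun X => rep_eval r X = 0).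
  by exists (fun s => s = r) => X; split=> [h s -> // | ]; apply.
have cover X : A X -> rep_eval p X = 0 \/ rep_eval q X = 0.
  move=> AX; have /eqP := pq0 X AX; rewrite /rep_eval mevalM mulf_eq0.
  by case/orP => /eqP; [left | right].
by case: (irrA _ _ (closed p) (closed q) cover) => h; [left | right]; apply/set_family_vanishes.
Qed.

Lemma irreducible_family_dim (k : fieldType) T N (x : T -> 'rV[k]_N) :
  [pchar k] =i pred0 -> irreducible_family x -> exists n, family_dim x n.
Proof.
move=> char0 irr; have [K [c [y ygen]]] := generic_point_exists irr.
have [V tanV] := tangent_space_exists c x y.
by exists (\rank V); apply: tangent_space_dim tanV => //; case: irr.
Qed.

Lemma prod_family_dim (k : fieldType) T1 T2 N1 N2
    (x1 : T1 -> 'rV[k]_N1) (x2 : T2 -> 'rV[k]_N2) n1 n2 :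
    [pchar k] =i pred0 -> irreducible_family x1 -> irreducible_family x2 ->
    family_dim x1 n1 -> family_dim x2 n2 ->
  family_dim (prod_family x1 x2) (n1 + n2).
Proof.
move=> char0 irr1 irr2 dim1 dim2; have irr := prod_irreducible irr1 irr2.
have [K [c [y ygen]]] := generic_point_exists irr.
have [V tanV] := tangent_space_exists c (prod_family x1 x2) y.
have [ne1 _] := irr1; have [ne2 _] := irr2; have [ne _] := irr.
rewrite -(prod_tangent_dim char0 ne1 ne2 ygen tanV dim1 dim2).
exact: tangent_space_dim tanV.
Qed.

(** By [assemble_deriv_eq0] the component nu is injective on the kernel of the
    differential and maps it to homomorphisms. *)
Lemma rank_ker_jacobian_assemble (k K : fieldType) (c : {rmorphism k -> K})
    (Q : quiver) (d e : dimvec Q) (y : 'rV[K]_(_)) :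
  (\rank (kermx (jacobian c (@assemble Q d e _ (vars k _)) y)) <=
   \rank (kermx (hom_mx (partN y) (partM y))))%N.
Proof.
set J := jacobian _ _ _; set W := kermx J.
have nuM m n (U : 'M_(m, n)) (S : 'M_(n, _)) : partnu (U *m S) = U *m @partnu Q d e K n S.
  by rewrite /partnu !mulmx_rsub.
have kerJ (v : 'rV_(_)) : v *m J = 0 ->
    partnu v *m hom_mx (partN y) (partM y) = 0 /\ (partnu v = 0 -> v = 0).
  rewrite /J mul_jacobian => Dv.
  have blocks a := assemble_deriv_eq0 a (dderiv_derivation c y v) Dv.
  move: blocks; rewrite evalK_vars dderiv_vars /= => blocks; split.
    rewrite mul_hom_mx; apply: block_inj => a; rewrite unblockK block0.
    by have [-> _ _ _] := blocks a; rewrite subrr.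
  move=> v0; rewrite v0 in blocks.
  have M0 : partM v = 0.
    by apply: block_inj => a; have [_ -> _ _] := blocks a; rewrite !block0 mulmx0 oppr0.
  have xi0 : partxi v = 0 by apply: block_inj => a; have [_ _ -> _] := blocks a; rewrite block0.
  have N0 : partN v = 0.
    by apply: block_inj => a; have [_ _ _ ->] := blocks a; rewrite !block0 mul0mx.
  rewrite -[v]hsubmxK -[rsubmx v]hsubmxK -[rsubmx (rsubmx v)]hsubmxK.
  rewrite [lsubmx v]M0 [lsubmx (rsubmx v)]N0 [lsubmx (rsubmx _)]xi0.
  by rewrite [rsubmx (rsubmx _)]v0 !row_mx0.
have WJ (u : 'rV_(_)) : u *m W *m J = 0 by rewrite -mulmxA mulmx_ker mulmx0.
have rank_nu : (\rank W <= \rank (partnu W))%N.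
  have : (kermx (partnu W) <= kermx W)%MS.
    apply/sub_kermxP/row_matrixP => i; rewrite row0 row_mul.
    have [_ inj] := kerJ _ (WJ (row i (kermx (partnu W)))).
    by apply: inj; rewrite nuM -row_mul mulmx_ker row0.
  move/mxrankS; rewrite !mxrank_ker.
  have := rank_leq_row W; have := rank_leq_row (partnu W); lia.
apply: leq_trans rank_nu _; apply: mxrankS; apply/sub_kermxP/row_matrixP => i.
rewrite row0 row_mul [row i _]rowE -nuM; exact: (kerJ _ (WJ _)).1.
Qed.

Theorem proposition2p5 (k : closedFieldType) (char0 : [pchar k] =i pred0)
    (Q : quiver) (acyclicQ : acyclic_quiver Q) (d e : dimvec Q)
    (A : rep k d -> Prop) (B : rep k e -> Prop)
    (MA : in_MQ A) (MB : in_MQ B) :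
  exists r : nat,
    codim (extension_set A B)
      = codim A + codim B
        - euler (fun i => (e i)%:Z) (fun i => (d i)%:Z) + r%:Z
    /\ (r <= min_hom B A)%N.
Proof.
have [irrA _ stA] := MA; have [irrB _ stB] := MB.
pose xA := @set_family k Q d A; pose xB := @set_family k Q e B.
have irrA' : irreducible_family xA := set_family_irreducible irrA.
have irrB' : irreducible_family xB := set_family_irreducible irrB.
have [a dimA] := irreducible_family_dim char0 irrA'.
have [b dimB] := irreducible_family_dim char0 irrB'.
pose NM := #|mxcoord (fun a : arrow Q => d (src a)) (fun a => d (tgt a))|.
pose NN := #|mxcoord (fun a : arrow Q => e (src a)) (fun a => e (tgt a))|.
pose Nxi := #|mxcoord (fun a : arrow Q => d (src a)) (fun a => e (tgt a))|.
pose Nnu := #|mxcoord e d|.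
(* The off-diagonal coordinates xi and nu range over an affine space. *)
pose free : 'rV[k]_(Nxi + Nnu) -> _ := id.
have irrF : irreducible_family free := full_irreducible char0 _.
have dimF : family_dim free (Nxi + Nnu) := full_family_dim _ char0.
have irrBF := prod_irreducible irrB' irrF.
have dimBF := prod_family_dim char0 irrB' irrF dimB dimF.
pose x := prod_family xA (prod_family xB free).
have irr : irreducible_family x := prod_irreducible irrA' irrBF.
have [ne _] := irr; have [neA _] := irrA'; have [neBF _] := irrBF.
have [K [c [y ygen]]] := generic_point_exists irr.
have [V tanV] := tangent_space_exists c x y.
have rankV := prod_tangent_dim char0 neA neBF ygen tanV dimA dimBF.
pose phi := assemble (vars k (NM + (NN + (Nxi + Nnu)))).
have xphi t : image_family phi x t = assemble (x t).
  by rewrite /image_family map_assemble meval_vars.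
have dimE : variety_dim (extension_set A B) = \rank (V *m jacobian c phi y).
  apply: variety_dim_family (image_family_dim char0 phi ne ygen tanV) => p.
  split=> [p0 [[M AM] [[N BN] u]] | p0].
    rewrite xphi -[assemble _]pointK -rep_evalE; apply: p0.
    apply: assemble_extension; rewrite /partM /partN /x /prod_family /=.
      by rewrite row_mxKl coordsK.
    by rewrite row_mxKr row_mxKl coordsK.
  apply: extension_dense => // w Aw Bw.
  have := p0 (exist _ _ Aw, (exist _ _ Bw, rsubmx (rsubmx w))).
  rewrite xphi rep_evalE pointK /x /prod_family /= /xA /xB /set_family /= !pointK.
  by rewrite !hsubmxK.
(* The kernel of the differential on the tangent space: the fibre dimension. *)
pose r := \rank (V :&: kermx (jacobian c phi y))%MS.
have rE : (\rank (V *m jacobian c phi y) + r)%N = (a + (b + (Nxi + Nnu)))%N.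
  by rewrite -rankV; apply: mxrank_mul_ker.
exists r; split.
  have full (f : dimvec Q) : variety_dim (fun _ : rep k f => True) =
      #|mxcoord (fun a : arrow Q => f (src a)) (fun a => f (tgt a))|.
    apply: variety_dim_family (full_family_dim _ char0) => p; split=> [h t | h X _].
      by rewrite -[t]pointK -rep_evalE h.
    by rewrite rep_evalE.
  rewrite /codim !full dimE.
  rewrite (variety_dim_family (@set_family_vanishes _ _ _ A) dimA).
  rewrite (variety_dim_family (@set_family_vanishes _ _ _ B) dimB).
  have sumZ (I : finType) (F G : I -> nat) :
      \sum_i (F i)%:Z * (G i)%:Z = (\sum_i F i * G i)%N%:Z.
    by rewrite -[RHS]natz natr_sum; apply: eq_bigr => i _; rewrite natrM !natz.
  have cardX : #|mxcoord (fun a => dimvec_add d e (src a)) (fun a => dimvec_add d e (tgt a))|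
      = (NM + NN + Nxi + \sum_(a0 : arrow Q) e (src a0) * d (tgt a0))%N.
    rewrite /NM /NN /Nxi !card_mxcoord -!big_split /=; apply: eq_bigr => a0 _.
    by rewrite /dimvec_add mulnDl !mulnDr; lia.
  rewrite /euler !sumZ -(card_mxcoord e d); move: rE cardX.
  set NX := #|mxcoord (fun a : arrow Q => dimvec_add d e (src a)) _|.
  move: (\rank (V *m _)) => D rE ->; rewrite -/NM -/NN -/Nnu; lia.
have [N0 [M0 [BN0 AM0 ->]]] : exists (N : rep k e) (M : rep k d),
    [/\ B N, A M & min_hom B A = \dim (Defs.Hom N M)].
  apply: (@minimum_spec (fun n => exists (N : rep k e) (M : rep k d),
    [/\ B N, A M & n = \dim (Defs.Hom N M)])).
  case: irrA irrB => [[M AM] _] [[N BN] _].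
  by exists (\dim (Defs.Hom N M)), N, M.
apply: leq_trans (dim_Hom_ge N0 M0).
apply: leq_trans (mxrankS (capmxSr _ _)) _.
apply: leq_trans (rank_ker_jacobian_assemble c y) _.
rewrite !mxrank_ker leq_sub2l //.
(* Specialize the generic pair (N, M) to (N0, M0). *)
pose t0 : {X | A X} * ({X | B X} * 'rV[k]_(Nxi + Nnu)) := (exist _ M0 AM0, (exist _ N0 BN0, 0)).
have := rank_generic_point_ge (hom_mx (partN (vars k _)) (partM (vars k _))) t0 ygen.
rewrite !map_hom_mx /partN /partM !map_lsubmx !map_rsubmx meval_vars evalK_vars.
by rewrite /x /prod_family /= !(row_mxKl, row_mxKr).
Qed.
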